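(* Let $d,m\in\mathbb{N}$, and let $\boldsymbol{\gamma}:\mathbb{R}^d\times\mathbb{R}^d\to(0,\infty)^{m\times m}$ be a positive (i.e. with positive entries), conditionally negative definite matrix-valued kernel. Let $s>0$ and $\nu\ge\frac{d+1}{2}$. Then the matrix-valued kernel $\boldsymbol{C}:\mathbb{R}^d\times\mathbb{R}^d\to\mathbb{R}^{m\times m}$ defined by $$C_{ij}(\boldsymbol{x},\boldsymbol{y})=s^{\nu+1}B(\gamma_{ij}(\boldsymbol{x},\boldsymbol{y})+1,\nu+1)\,\Psi_{\nu+\gamma_{ij}(\boldsymbol{x},\boldsymbol{y})+1}\left(\frac{\lVert\boldsymbol{x}-\boldsymbol{y}\rVert}{s}\right),\qquad \boldsymbol{x},\boldsymbol{y}\in\mathbb{R}^d,\ i,j=1,\dots,m,$$ where $\Psi_\kappa(t):=(1-t)_+^\kappa:=\max\{1-t,0\}^\kappa$ and $B$ denotes the Beta function, is positive definite and compactly supported.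
   Context: A matrix-valued kernel $\boldsymbol{C}:\mathbb{R}^d\times\mathbb{R}^d\to\mathbb{R}^{m\times m}$ with $C_{ij}(\boldsymbol{x},\boldsymbol{y})=C_{ji}(\boldsymbol{y},\boldsymbol{x})$ is called positive definite if $\sum_{i,j=1}^n\boldsymbol{a}_i^\top\boldsymbol{C}(\boldsymbol{x}_i,\boldsymbol{x}_j)\boldsymbol{a}_j\ge0$ for all $n\in\mathbb{N}$, $\boldsymbol{x}_1,\dots,\boldsymbol{x}_n\in\mathbb{R}^d$, $\boldsymbol{a}_1,\dots,\boldsymbol{a}_n\in\mathbb{R}^m$. A matrix-valued kernel $\boldsymbol{\gamma}:\mathbb{R}^d\times\mathbb{R}^d\to\mathbb{R}^{m\times m}$ is conditionally negative definite if $\gamma_{ij}(\boldsymbol{x},\boldsymbol{y})=\gamma_{ji}(\boldsymbol{y},\boldsymbol{x})$ for all $\boldsymbol{x},\boldsymbol{y},i,j$, and $\sum_{i,j=1}^n\boldsymbol{a}_i^\top\boldsymbol{\gamma}(\boldsymbol{x}_i,\boldsymbol{x}_j)\boldsymbol{a}_j\le0$ for all $n\in\mathbb{N}$, $\boldsymbol{x}_i\in\mathbb{R}^d$, $\boldsymbol{a}_i\in\mathbb{R}^m$ such that $\boldsymbol{1}_m^\top\sum_{k=1}^n\boldsymbol{a}_k=0$, where $\boldsymbol{1}_m=(1,\dots,1)^\top\in\mathbb{R}^m$. $\lVert\cdot\rVert$ is the Euclidean norm. ''Compactly supported'' for a kernel means that $\boldsymbol{C}(\boldsymbol{x},\boldsymbol{y})=0$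 whenever $\lVert\boldsymbol{x}-\boldsymbol{y}\rVert$ is sufficiently large. *)

(* Defs.v *)
From HB Require Import structures.
From mathcomp Require Import all_boot all_order all_algebra.
From mathcomp Require Import all_classical all_reals all_analysis.

Set Implicit Arguments.
Unset Strict Implicit.
Unset Printing Implicit Defensive.

Import Order.TTheory GRing.Theory Num.Theory.
Import numFieldNormedType.Exports.

Local Open Scope classical_set_scope.
Local Open Scope ring_scope.

(* The canonical norm `|x| on matrices is the sup norm, hence this one. *)
Definition euclidean_norm (R : realType) (d : nat) (x : 'cV[R]_d) : R :=
  Num.sqrt (\sum_(k < d) x k 0 ^+ 2).

(* The library's beta_fun only takes natural number arguments.  The integrand
   is integrable exactly when a, b > 0; the value is meaningless otherwise. *)
Definition Beta (R : realType) (a b : R) : R :=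
  \int[@lebesgue_measure R]_(t in `]0, 1[)
    (t `^ (a - 1) * (1 - t) `^ (b - 1)).

Definition Psi (R : realType) (kappa t : R) : R :=
  (Num.max (1 - t) 0) `^ kappa.

Definition mkernel (R : realType) (d m : nat) : Type :=
  'cV[R]_d -> 'cV[R]_d -> 'M[R]_m.

Definition kernel_symmetric (R : realType) (d m : nat) (K : mkernel R d m) :
    Prop :=
  forall (x y : 'cV[R]_d) (i j : 'I_m), K x y i j = K y x j i.

Definition kernel_form (R : realType) (d m : nat) (K : mkernel R d m)
    (n : nat) (x : 'I_n -> 'cV[R]_d) (a : 'I_n -> 'cV[R]_m) : R :=
  \sum_(i < n) \sum_(j < n) ((a i)^T *m K (x i) (x j) *m a j) 0 0.

Definition positive_definite (R : realType) (d m : nat) (K : mkernel R d m) :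
    Prop :=
  kernel_symmetric K /\
  forall (n : nat) (x : 'I_n -> 'cV[R]_d) (a : 'I_n -> 'cV[R]_m),
    0 <= kernel_form K x a.

Definition conditionally_negative_definite (R : realType) (d m : nat)
    (K : mkernel R d m) : Prop :=
  kernel_symmetric K /\
  forall (n : nat) (x : 'I_n -> 'cV[R]_d) (a : 'I_n -> 'cV[R]_m),
    (const_mx 1 : 'cV[R]_m)^T *m (\sum_(k < n) a k) = 0 ->
    kernel_form K x a <= 0.

Definition compactly_supported (R : realType) (d m : nat) (K : mkernel R d m) :
    Prop :=
  exists r : R, forall x y : 'cV[R]_d, r < euclidean_norm (x - y) -> K x y = 0.

(* Main.v *)
(* The kernel is a mixture over t in (0, 1) of Schur products: up to a constant,
   C_ij(x, y) is the integral of t^nu (1 - r / (s t))_+^nu (1 - t)^gamma_ij(x, y)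
   with r = |x - y|.  The factor (1 - t)^gamma is positive definite by
   Schoenberg's theorem, so it remains to treat the Askey function
   (1 - r)_+^nu on R^d for nu >= (d + 1) / 2.

   For W nonincreasing, the integral over z in R^d of
   min (W |x - z|^2) (W |y - z|^2) is positive definite in x and y.  The
   minimum is attained at the farther of x and y, so splitting along their
   bisecting hyperplane gives twice the integral over t > r / 2 of the
   (d - 1)-fold marginal of W at distance t; the Askey function arises when this
   marginal is (1 - t)_+^(nu - 1).  Two marginals amount, up to pi, to one primitive in t^2, hence
   for d = 2 k + 1 one takes the k-th derivative W = (- d / d(t^2))^k of
   (1 - t)_+^(nu - 1), which is a sum of products of nonincreasing functions of
   the form (1 - t)_+^a t^-b.  For even d the same argument applies after a
   further explicit mixture.  As W is singular at the origin, squared distances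
   are shifted by p > 0 and p tends to 0 at the end.

   No measure on R^d is needed: the integral over R^d is iterated, and the
   dependence on r alone follows by induction on d from rotation invariance in
   the plane. *)
Require Import Defs.
From HB Require Import structures.
From mathcomp Require Import all_boot all_order all_algebra.
From mathcomp Require Import all_classical all_reals all_analysis.
From mathcomp Require Import ring lra measurable_realfun.

Set Implicit Arguments.
Unset Strict Implicit.
Unset Printing Implicit Defensive.

Import Order.TTheory GRing.Theory Num.Theory.
Import numFieldNormedType.Exports.

Local Open Scope classical_set_scope.
Local Open Scope ring_scope.

(** * Positive semidefinite forms *)
Section psd.
Context {R : realType}.

(** The index type is an arbitrary finite type, so that pairs of a point and a component can serve
    as indices. *)
Definition qform (I : finType) (A : I -> I -> R) (c : I -> R) : R :=
  \sum_i \sum_j c i * c j * A i j.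

Definition psd (I : finType) (A : I -> I -> R) : Prop :=
  forall c, 0 <= qform A c.

Definition symm (I : finType) (A : I -> I -> R) : Prop :=
  forall i j, A i j = A j i.

Lemma eq_psd (I : finType) (A B : I -> I -> R) :
  (forall i j, A i j = B i j) -> psd A -> psd B.
Proof.
move=> AB pA c; have := pA c; congr (0 <= _).
by apply: eq_bigr => i _; apply: eq_bigr => j _; rewrite AB.
Qed.

Lemma sum_delta (I : finType) (o : I) (F : I -> R) :
  \sum_i F i * (i == o)%:R = F o.
Proof.
rewrite (bigD1 o)//= eqxx mulr1 big1 ?addr0// => i /negbTE ->.
by rewrite mulr0.
Qed.

(** A quadratic polynomial in [t]: its coefficients give the diagonal facts, the Schur complement
    and the base-point reduction below. *)
Lemma form_add_delta (I : finType) (A : I -> I -> R) c t o : symm A ->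
  qform A (fun i => c i + t * (i == o)%:R) =
  qform A c + 2 * t * (\sum_i c i * A i o) + t ^+ 2 * A o o.
Proof.
move=> sA; rewrite /qform.
transitivity (\sum_i (\sum_j c i * c j * A i j + t * (c i * A i o)
  + (\sum_j t * c j * A i j + t ^+ 2 * A i o) * (i == o)%:R)).
  apply: eq_bigr => i _.
  transitivity (\sum_j (c i * c j * A i j + (c i * t * A i j) * (j == o)%:R
     + (t * c j * A i j + t ^+ 2 * A i j * (j == o)%:R) * (i == o)%:R)).
    by apply: eq_bigr => j _; ring.
  rewrite !big_split/= -!big_distrl/= !big_split/= !sum_delta; ring.
rewrite big_split/= sum_delta big_split/= -big_distrr/= -!addrA; congr (_ + _).
under [X in _ + (X + _)]eq_bigr do rewrite -mulrA sA.
by rewrite -big_distrr/=; ring.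
Qed.

Lemma psd_diag_ge0 (I : finType) (A : I -> I -> R) i : symm A -> psd A -> 0 <= A i i.
Proof.
move=> sA /(_ (fun j => 0 + 1 * (j == i)%:R)); rewrite form_add_delta//.
rewrite /qform big1 ?add0r; last by move=> j _; rewrite big1// => k _; rewrite !mul0r.
rewrite big1 ?mulr0 ?add0r; last by move=> j _; rewrite !mul0r.
by rewrite expr1n mul1r.
Qed.

(** With [A i i = 0] the form at [e_j + t e_i] is affine in [t]; being nonnegative for all [t], it
    has slope zero. *)
Lemma psd_diag0 (I : finType) (A : I -> I -> R) i j : symm A -> psd A ->
  A i i = 0 -> A i j = 0.
Proof.
move=> sA pA Ai0.
have H t : 0 <= A j j + 2 * t * A i j.
  have := pA (fun k => (0 + 1 * (k == j)%:R) + t * (k == i)%:R).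
  rewrite form_add_delta// Ai0 mulr0 addr0 form_add_delta//.
  rewrite /qform big1 ?add0r; last by move=> k _; rewrite big1// => l _; rewrite !mul0r.
  rewrite big1 ?mulr0 ?add0r; last by move=> k _; rewrite !mul0r.
  rewrite expr1n mul1r.
  under eq_bigr do rewrite add0r mul1r mulrC.
  by rewrite sum_delta [A j i]sA.
apply/eqP; apply: contraT => Aij0.
(* At this [t] the affine function takes the value -1. *)
have := H (- (A j j + 1) / (2 * A i j)).
suff -> : A j j + 2 * (- (A j j + 1) / (2 * A i j)) * A i j = -1 by lra.
by field.
Qed.

(** Induction on the number of nonzero diagonal entries of [A]. Splitting off the rank-one part
    through a pivot [b0] leaves a Schur complement [A'] with fewer of them; the product of the
    rank-one part with [B] is a congruence of [B]. *)
Lemma psd_schur (I : finType) (A B : I -> I -> R) : symm A -> psd A -> psd B ->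
  psd (fun i j => A i j * B i j).
Proof.
move=> + + pB; have [n] := ubnP #|[pred i | A i i != 0]|.
elim: n A => // n IH A; rewrite ltnS => nA sA pA c.
have [ [b0 Ao]|noA] := pselect (exists i, A i i != 0); last first.
  rewrite /qform big1// => i _; rewrite big1// => j _.
  rewrite [A i j]psd_diag0 ?mul0r ?mulr0//.
  by apply/eqP; apply: contra_notT noA => Ai; exists i.
have Ao0 : 0 < A b0 b0 by rewrite lt_neqAle eq_sym Ao psd_diag_ge0.
pose A' i j := A i j - A i b0 * A j b0 / A b0 b0.
have sA' : symm A' by move=> i j; rewrite /A' sA [A i b0 * _]mulrC.
have pA' : psd A'.
  (* The shift along the pivot minimizes the form of [A], and the minimum is the form of [A']. *)
  move=> e; have := pA (fun i => e i + (- (\sum_i e i * A i b0) / A b0 b0) * (i == b0)%:R).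
  rewrite form_add_delta//; set s := \sum_i _.
  suff -> : qform A' e = qform A e - s ^+ 2 / A b0 b0.
    by congr (0 <= _); field.
  rewrite /qform expr2 /s big_distrlr/= mulr_suml -sumrB; apply: eq_bigr => i _.
  rewrite mulr_suml -sumrB; apply: eq_bigr => j _; rewrite /A'; ring.
have nA' : (#|[pred i | (A' i i != 0)%R]| < n)%N.
  apply: leq_trans nA; apply/proper_card/properP; split.
    apply/fintype.subsetP => i; rewrite !inE; apply: contraNN => /eqP Ai0.
    by rewrite /A' Ai0 (psd_diag0 b0 sA pA Ai0)// !mul0r subr0.
  exists b0; rewrite !inE// /A' negbK subr_eq0.
  by apply/eqP; field.
have -> : qform (fun i j => A i j * B i j) c =
  qform (fun i j => A' i j * B i j) c + (A b0 b0)^-1 * qform B (fun i => c i * A i b0).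
  rewrite /qform mulr_sumr -big_split/=; apply: eq_bigr => i _.
  rewrite mulr_sumr -big_split/=; apply: eq_bigr => j _; rewrite /A'.
  ring.
by rewrite addr_ge0 ?IH// mulr_ge0 ?invr_ge0 ?(ltW Ao0).
Qed.

Lemma psd_sum (I : finType) (J : Type) (s : seq J) (A : J -> I -> I -> R) :
  (forall k, psd (A k)) -> psd (fun i j => \sum_(k <- s) A k i j).
Proof.
move=> pA c.
suff -> : qform (fun i j => \sum_(k <- s) A k i j) c = \sum_(k <- s) qform (A k) c.
  by apply: sumr_ge0 => k _; exact: pA.
rewrite /qform [RHS]exchange_big/=; apply: eq_bigr => i _.
rewrite [RHS]exchange_big/=; apply: eq_bigr => j _; by rewrite mulr_sumr.
Qed.

Lemma psdZ (I : finType) (A : I -> I -> R) k : 0 <= k -> psd A ->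
  psd (fun i j => k * A i j).
Proof.
move=> k0 pA c.
suff -> : qform (fun i j => k * A i j) c = k * qform A c by rewrite mulr_ge0.
rewrite /qform mulr_sumr; apply: eq_bigr => i _.
by rewrite mulr_sumr; apply: eq_bigr => j _; ring.
Qed.

Lemma psd_congr (I : finType) (A : I -> I -> R) (e : I -> R) : psd A ->
  psd (fun i j => e i * e j * A i j).
Proof.
move=> pA c; have := pA (fun i => c i * e i); congr (0 <= _).
by apply: eq_bigr => i _; apply: eq_bigr => j _; ring.
Qed.

Lemma psd_rank1 (I : finType) (e : I -> R) : psd (fun i j => e i * e j).
Proof.
move=> c; suff -> : qform (fun i j => e i * e j) c = (\sum_i c i * e i) ^+ 2.
  exact: sqr_ge0.
rewrite expr2 big_distrlr/=; apply: eq_bigr => i _.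
by apply: eq_bigr => j _; ring.
Qed.

Lemma psd_lim (I : finType) (A : nat -> I -> I -> R) (B : I -> I -> R) :
  (forall n, psd (A n)) -> (forall i j, A n i j @[n --> \oo] --> B i j) -> psd B.
Proof.
move=> pA AB c.
have cv : qform (A n) c @[n --> \oo] --> qform B c.
  rewrite /qform; apply: cvg_big => [|i _]; first exact: add_continuous.
  apply: cvg_big => [|j _]; first exact: add_continuous.
  by apply: cvgM; [exact: cvg_cst|exact: AB].
rewrite -(cvg_lim _ cv)//; apply: limr_ge; first by apply/cvg_ex; eexists; exact: cv.
by apply: nearW => n; exact: pA.
Qed.

(** Powers are Schur products, partial sums of the exponential series are nonnegative combinations
    of them, and the cone is closed under limits. *)
Lemma psd_expR (I : finType) (A : I -> I -> R) : symm A -> psd A ->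
  psd (fun i j => expR (A i j)).
Proof.
move=> sA pA; apply: (@psd_lim _ (fun n i j => series (exp_coeff (A i j)) n)).
  move=> n; apply: psd_sum => k.
  have pX : psd (fun i j => A i j ^+ k).
    elim: k => [|k IH].
      have := @psd_rank1 I (fun=> 1); rewrite /psd => H c; have := H c.
      by congr (0 <= _); apply: eq_bigr => i _; apply: eq_bigr => j _; rewrite expr0 mulr1.
    have := psd_schur sA pA IH; rewrite /psd => H c; have := H c.
    by congr (0 <= _); apply: eq_bigr => i _; apply: eq_bigr => j _; rewrite exprS.
  have := @psdZ _ _ (k`!%:R)^-1 _ pX; rewrite invr_ge0 ler0n => /(_ isT) H c.
  have := H c; congr (0 <= _).
  by apply: eq_bigr => i _; apply: eq_bigr => j _; rewrite /exp_coeff/= [_ / _]mulrC.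
by move=> i j; exact: is_cvg_series_exp_coeff.
Qed.

(* With a base point [b0], [g i b0 + g j b0 - g i j - g b0 b0] is positive
   semidefinite, so its exponential is as well. *)
Lemma psd_exp_cnd (I : finType) (g : I -> I -> R) t : 0 <= t -> symm g ->
  (forall c : I -> R, \sum_i c i = 0 -> qform g c <= 0) ->
  psd (fun i j => expR (- t * g i j)).
Proof.
move=> t0 sg cnd.
have [ [b0 _]|noI] := pselect (exists i : I, True); last first.
  by move=> c; rewrite /qform big1// => i; case: noI; exists i.
pose B i j := t * (g i b0 + g j b0 - g i j - g b0 b0).
have sB : symm B by move=> i j; rewrite /B [g i j]sg; congr (_ * _); ring.
have pB : psd B.
  apply: psdZ => // c.
  (* Compensating the total of [c] at the base point makes the coefficients sum to zero. *)
  have := cnd (fun i => c i + (- \sum_i c i) * (i == b0)%:R).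
  rewrite form_add_delta// big_split/= -big_distrr/=.
  have -> : \sum_i (i == b0)%:R = 1 :> R.
    by under eq_bigr do rewrite -[(_ == _)%:R]mul1r; rewrite sum_delta.
  rewrite mulr1 subrr => /(_ erefl); rewrite -oppr_ge0; congr (0 <= _).
  set s := \sum_i c i; set u := \sum_i c i * g i b0.
  transitivity (\sum_i (- (\sum_j c i * c j * g i j) + s * (c i * g i b0) + c i * u - s * g b0 b0 * c i)).
    rewrite !big_split/= -!big_distrr/= -big_distrl/= -sumrN.
    rewrite -/s -/u /qform !sumrN -mulr_sumr -/s. ring.
  apply: eq_bigr => i _; rewrite /s /u !mulr_suml mulr_sumr -sumrN -!big_split/=.
  by rewrite -sumrN -!big_split/=; apply: eq_bigr => j _; ring.
(* This diagonal congruence cancels the base-point terms, half of the constant [t * g b0 b0] going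
   to each side. *)
have := psd_congr (fun i => expR (- t * g i b0 + t * g b0 b0 / 2)) (psd_expR sB pB).
rewrite /psd => H c; have := H c; congr (0 <= _).
apply: eq_bigr => i _; apply: eq_bigr => j _; congr (_ * _).
by rewrite -!expRD; congr expR; rewrite /B; field.
Qed.

End psd.

(** * Integrals over the line *)
Section integral_line.
Local Open Scope ereal_scope.
Context {R : realType}.
Local Notation mu := (@lebesgue_measure R).
Implicit Types f : R -> \bar R.

Lemma tonelli_line (f : R -> R -> \bar R) :
  measurable_fun setT (fun z : R * R => f z.1 z.2) -> (forall x y, 0 <= f x y) ->
  \int[mu]_x \int[mu]_y f x y = \int[mu]_y \int[mu]_x f x y.
Proof.
move=> mf f0.
by apply: (@fubini_tonelli _ _ _ _ R mu mu (fun z => f z.1 z.2)) => // z; exact: f0.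
Qed.

Lemma measurable_integral_param d (T : measurableType d) (f : T -> R -> \bar R) :
  measurable_fun setT (fun z : T * R => f z.1 z.2) -> (forall x y, 0 <= f x y) ->
  measurable_fun setT (fun x => \int[mu]_y f x y).
Proof.
move=> mf f0.
by apply: (@measurable_fun_fubini_tonelli_F _ _ T _ R mu (fun z => f z.1 z.2)) => // z; exact: f0.
Qed.

Lemma integral_oppr f : measurable_fun setT f -> (forall x, 0 <= f x) ->
  \int[mu]_x f (- x)%R = \int[mu]_x f x.
Proof.
move=> mf f0.
have mN : measurable_fun setT (-%R : measurableTypeR R -> measurableTypeR R) by exact: oppr_measurable.
transitivity (\int[pushforward mu (-%R : measurableTypeR R -> measurableTypeR R)]_x f x).
  by rewrite (ge0_integral_pushforward mN).
by apply: eq_measure_integral => //= A mA _; exact: lebesgue_measureN.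
Qed.

(** The pushforward under a translation agrees with Lebesgue measure on half-open intervals, hence
    everywhere by uniqueness. [integral_scale] argues likewise. *)
Lemma integral_translate f b : measurable_fun setT f -> (forall x, 0 <= f x) ->
  \int[mu]_x f (x + b)%R = \int[mu]_x f x.
Proof.
move=> mf f0; pose phi (x : measurableTypeR R) : measurableTypeR R := (x + b)%R.
have mphi : measurable_fun setT phi by exact: measurable_funD.
transitivity (\int[pushforward mu phi]_x f x).
  by rewrite (ge0_integral_pushforward mphi).
pose mphi_mixin := isMeasurableFun.Build _ _ _ _ _ mphi.
pose P : {mfun _ >-> _} := HB.pack phi mphi_mixin.
apply: eq_measure_integral => //= A mA _; apply/esym.
apply: (@lebesgue_measure_unique R (pushforward mu P)) => //= _ [[x y]] _ <-.
rewrite /pushforward/=.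
have -> : phi @^-1` `]x, y] = `](x - b)%R, (y - b)%R]%classic.
  by apply/seteqP; split=> z; rewrite /phi /= !in_itv/= lerBrDr ltrBlDr.
rewrite !lebesgue_measure_itv/= !lte_fin ltrD2r; case: ifP => // _.
by rewrite -!EFinB; congr (_%:E); ring.
Qed.

Lemma integral_scale f a : (0 < a)%R -> measurable_fun setT f -> (forall x, 0 <= f x) ->
  a%:E * \int[mu]_x f (a * x)%R = \int[mu]_x f x.
Proof.
move=> a0 mf f0; pose phi (x : measurableTypeR R) : measurableTypeR R := (a * x)%R.
have mphi : measurable_fun setT phi by exact: measurable_funM.
pose mphi_mixin := isMeasurableFun.Build _ _ _ _ _ mphi.
pose P : {mfun _ >-> _} := HB.pack phi mphi_mixin.
transitivity (a%:E * \int[pushforward mu P]_x f x).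
  by rewrite (ge0_integral_pushforward mphi).
have a0' := ltW a0.
rewrite -[a]/((NngNum a0')%:num)%R -ge0_integral_mscale//.
apply: eq_measure_integral => //= A mA _; apply/esym.
apply: (@lebesgue_measure_unique R (mscale (NngNum a0') (pushforward mu P))) => //= _ [[x y]] _ <-.
rewrite /mscale/= /pushforward/=.
have -> : phi @^-1` `]x, y] = `](a^-1 * x)%R, (a^-1 * y)%R]%classic.
  by apply/seteqP; split=> z; rewrite /phi /= !in_itv/= ler_pdivlMl// ltr_pdivrMl.
rewrite !lebesgue_measure_itv/= !lte_fin ltr_pM2l ?invr_gt0//. case: ifP => // _; last by rewrite mule0.
by rewrite -!EFinB -mulrBr -EFinM mulrA mulfV ?gt_eqF// mul1r.
Qed.

(** The mixture principle behind every positivity proof below: the quadratic form of the integral is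
    the integral of the quadratic forms. *)
Lemma psd_integral (I : finType) (k : R -> I -> I -> R) :
  (forall t, psd (k t)) -> (forall t i j, (0 <= k t i j)%R) ->
  (forall i j, measurable_fun setT (fun t => k t i j)) ->
  (forall i j, \int[mu]_t (k t i j)%:E < +oo) ->
  psd (fun i j => fine (\int[mu]_t (k t i j)%:E)).
Proof.
move=> pk k0 mk fk c; rewrite /qform.
have ik i j : mu.-integrable setT (EFin \o (fun t => k t i j)).
  apply/integrableP; split; first by apply/measurable_EFinP; exact: mk.
  rewrite /=; under eq_integral do rewrite ger0_norm//.
  exact: fk.
have ik2 i j : mu.-integrable setT (EFin \o (fun t => c i * c j * k t i j)%R).
  apply: (eq_integrable measurableT _ _ _ (integrableZl measurableT (c i * c j)%R (ik i j))).
  by move=> t _ /=; rewrite -EFinM.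
suff -> : (\sum_i \sum_j c i * c j * fine (\int[mu]_t (k t i j)%:E)
          = \int[mu]_t qform (k t) c)%R.
  by apply: Rintegral_ge0 => t _; exact: pk.
apply: EFin_inj; rewrite /Rintegral fineK; last first.
  apply: integrable_fin_num => //; rewrite /qform.
  have : mu.-integrable setT (fun t => \sum_i \sum_j (c i * c j * k t i j)%:E).
    by apply: integrable_sum => // i _; apply: integrable_sum => // j _; exact: ik2.
  apply: eq_integrable => // t _.
  by rewrite -sumEFin; apply: eq_bigr => i _; rewrite -sumEFin.
rewrite /qform.
under eq_integral do rewrite -sumEFin; under eq_integral do under eq_bigr do rewrite -sumEFin.
rewrite integral_sum//; last by move=> i; apply: integrable_sum => // j _; exact: ik2.
rewrite -sumEFin; apply: eq_bigr => i _.
rewrite integral_sum//; last by move=> j; exact: ik2.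
rewrite -sumEFin; apply: eq_bigr => j _.
under [RHS]eq_integral do rewrite EFinM.
rewrite integralZl//; last exact: ik.
rewrite EFinM fineK// ge0_fin_numE ?fk//.
by apply: integral_ge0 => t _; rewrite lee_fin.
Qed.

End integral_line.

Ltac meas := repeat first
  [ assumption
  | exact: measurable_cst | exact: measurable_id
  | exact: measurable_fst | exact: measurable_snd
  | apply: measurable_funB | apply: measurable_funD | apply: measurable_funX
  | apply: measurable_funM | apply: oppr_measurable
  | apply: measurable_maxr
  | apply: (measurableT_comp measurable_fst)
  | apply: (measurableT_comp measurable_snd)
  | apply: (measurableT_comp oppr_measurable) ].

(** * Overlap integrals of balls *)
Section planar.
Local Open Scope ereal_scope.
Context {R : realType}.
Local Notation mu := (@lebesgue_measure R).
Implicit Types (f : R -> \bar R) (G : R -> R -> \bar R).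

Lemma measurable_fun2 d (T : measurableType d) G (u v : T -> R) :
  measurable_fun setT (fun z : R * R => G z.1 z.2) ->
  measurable_fun setT u -> measurable_fun setT v ->
  measurable_fun setT (fun t => G (u t) (v t)).
Proof.
move=> mG mu mv; exact: (measurableT_comp mG (measurable_fun_pair mu mv)).
Qed.

Arguments measurable_fun2 [d T G u v].

Lemma integral_shearx G t :
  measurable_fun setT (fun z : R * R => G z.1 z.2) -> (forall x y, 0 <= G x y) ->
  \int[mu]_x \int[mu]_y G (x + t * y)%R y = \int[mu]_x \int[mu]_y G x y.
Proof.
move=> mG G0; rewrite tonelli_line//; last first.
  by apply: (measurable_fun2 (u := fun z : R * R => (z.1 + t * z.2)%R) mG); meas.
rewrite [RHS]tonelli_line//; apply: eq_integral => y _.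
apply: (integral_translate (f := fun x => G x y)) => //.
by apply: (measurable_fun2 (u := id) (v := cst y) mG); meas.
Qed.

Lemma integral_sheary G t :
  measurable_fun setT (fun z : R * R => G z.1 z.2) -> (forall x y, 0 <= G x y) ->
  \int[mu]_x \int[mu]_y G x (y + t * x)%R = \int[mu]_x \int[mu]_y G x y.
Proof.
move=> mG G0; apply: eq_integral => x _.
apply: (integral_translate (f := fun y => G x y)) => //.
by apply: (measurable_fun2 (v := id) (u := cst x) mG); meas.
Qed.

(* A rotation of the plane is a product of three shears. *)
Lemma integral_rotate G c s : (c ^+ 2 + s ^+ 2 = 1)%R ->
  measurable_fun setT (fun z : R * R => G z.1 z.2) -> (forall x y, 0 <= G x y) ->
  \int[mu]_x \int[mu]_y G (c * x - s * y)%R (s * x + c * y)%R =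
  \int[mu]_x \int[mu]_y G x y.
Proof.
move=> cs mG G0.
(* The shear factor [(1 - c) / s] requires [s != 0]; otherwise the rotation is the identity or the
   central symmetry. *)
have [s0|s0] := eqVneq s 0%R.
  have : ((c - 1) * (c + 1) = 0)%R by rewrite s0 in cs; lra.
  move/eqP; rewrite mulf_eq0 => /orP[/eqP arcsine_mass|/eqP arcsine_mass].
    have -> : c = 1%R by lra.
    apply: eq_integral => x _; apply: eq_integral => y _.
    by rewrite s0; congr G; ring.
  have -> : c = (-1)%R by lra.
  rewrite s0.
  transitivity (\int[mu]_x \int[mu]_y G (- x)%R (- y)%R).
    apply: eq_integral => x _; apply: eq_integral => y _.
    by congr G; ring.
  transitivity (\int[mu]_x \int[mu]_y G (- x)%R y).
    apply: eq_integral => x _.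
    apply: (integral_oppr (f := fun y => G (- x)%R y)) => //.
    by apply: (measurable_fun2 (v := id) (u := cst (- x)%R) mG); meas.
  apply: (integral_oppr (f := fun x => \int[mu]_y G x y)) => //.
    exact: measurable_integral_param.
  by move=> x; apply: integral_ge0.
(* The tangent of the half angle: two horizontal shears by [- t] enclose a vertical one by [s]. *)
pose t := ((1 - c) / s)%R.
pose G1 x y := G (x + (- t) * y)%R y.
have mG1 : measurable_fun setT (fun z : R * R => G1 z.1 z.2).
  by apply: (measurable_fun2 mG); meas.
pose G2 x y := G1 x (y + s * x)%R.
have mG2 : measurable_fun setT (fun z : R * R => G2 z.1 z.2).
  by apply: (measurable_fun2 mG1); meas.
rewrite -[RHS](@integral_shearx _ (- t)%R)//.
rewrite -[RHS](@integral_sheary G1 s)//; last by move=> x y; exact: G0.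
rewrite -[RHS](@integral_shearx G2 (- t)%R)//; last by move=> x y; exact: G0.
apply: eq_integral => x _; apply: eq_integral => y _; rewrite /G2 /G1.
have tc : (1 - s * t = c)%R by rewrite /t; field.
have ts : (t * (1 + c) = s)%R.
  rewrite /t mulrAC; apply: (mulIf s0); rewrite mulfVK//; lra.
congr G.
  transitivity ((1 - s * t) * x - t * (1 + (1 - s * t)) * y)%R; last by ring.
  by rewrite tc ts.
by transitivity (s * x + (1 - s * t) * y)%R; [rewrite tc|ring].
Qed.

(* Radial functions are represented as functions of the squared distance, so
   [marginal f] is [f] with one coordinate integrated out, and [lens f p q r]
   is the overlap integral of two balls with centres at distance [r]. *)
Definition marginal f (p : R) : \bar R := \int[mu]_z f (p + z ^+ 2)%R.

Definition lens f (p q r : R) : \bar R :=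
  \int[mu]_z f (Num.max (p + (z - r) ^+ 2) (q + z ^+ 2))%R.

Lemma marginal_ge0 f p : (forall x, 0 <= f x) -> 0 <= marginal f p.
Proof. by move=> f0; apply: integral_ge0. Qed.

Lemma lens_ge0 f p q r : (forall x, 0 <= f x) -> 0 <= lens f p q r.
Proof. by move=> f0; apply: integral_ge0. Qed.

Lemma measurable_marginal f : measurable_fun setT f -> (forall x, 0 <= f x) ->
  measurable_fun setT (marginal f).
Proof.
move=> mf f0.
have mg : measurable_fun setT (fun z : R * R => f (z.1 + z.2 ^+ 2)%R).
  by apply: (measurableT_comp mf); meas.
exact: (measurable_integral_param (f := fun p z : R => f (p + z ^+ 2)%R) mg).
Qed.

Lemma measurable_lens f d (T : measurableType d) (p q r : T -> R) :
  measurable_fun setT f -> (forall x, 0 <= f x) ->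
  measurable_fun setT p -> measurable_fun setT q -> measurable_fun setT r ->
  measurable_fun setT (fun t => lens f (p t) (q t) (r t)).
Proof.
move=> mf f0 mp mq mr.
have mg : measurable_fun setT (fun z : T * R =>
    f (Num.max (p z.1 + (z.2 - r z.1) ^+ 2) (q z.1 + z.2 ^+ 2))%R).
  have m1 (u : T -> R) : measurable_fun setT u ->
      measurable_fun setT (fun z : T * R => u z.1).
    by move=> mu; exact: (measurableT_comp mu measurable_fst).
  apply: (measurableT_comp mf); apply: measurable_maxr;
    (apply: measurable_funD; first exact: m1); apply: measurable_funX => //.
  by apply: measurable_funB => //; exact: m1.
exact: (measurable_integral_param (f := fun (t : T) (z : R) =>
  f (Num.max (p t + (z - r t) ^+ 2) (q t + z ^+ 2))%R) mg).
Qed.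

(** A rotation carries the offset [(a, b)] to [(r, 0)]. The orthogonal coordinate then enters both
    squared distances alike and is integrated out as a marginal. *)
Lemma lens_planar f p q a b r : measurable_fun setT f -> (forall x, 0 <= f x) ->
  (r ^+ 2 = a ^+ 2 + b ^+ 2)%R ->
  \int[mu]_z lens f (p + (z - a) ^+ 2)%R (q + z ^+ 2)%R b = lens (marginal f) p q r.
Proof.
move=> mf f0 rab.
pose G z w := f (Num.max (p + (z - a) ^+ 2 + (w - b) ^+ 2) (q + z ^+ 2 + w ^+ 2))%R.
have mG : measurable_fun setT (fun z : R * R => G z.1 z.2).
  by apply: (measurableT_comp mf); meas.
have [c [s [cs ac bc]]] : exists c s, [/\ c ^+ 2 + s ^+ 2 = 1, a = r * c & b = r * s]%R.
  have [r0|r0] := eqVneq r 0%R.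
    move: rab; rewrite r0 expr0n/= => /esym/eqP.
    rewrite paddr_eq0 ?sqr_ge0// !sqrf_eq0 => /andP[/eqP -> /eqP ->].
    by exists 1%R, 0%R; split; ring.
  exists (a / r)%R, (b / r)%R; split; last 2 first.
  - by field.
  - by field.
  by rewrite !exprMn -mulrDl -rab exprVn mulfV// expf_eq0.
transitivity (\int[mu]_z \int[mu]_w G z w) => //.
rewrite -(integral_rotate cs mG (fun _ _ => f0 _)).
apply: eq_integral => z _; apply: eq_integral => w _; rewrite /G addr_maxl.
congr (f (Num.max _ _)).
  transitivity (p + (c ^+ 2 + s ^+ 2) * ((z - r) ^+ 2 + w ^+ 2))%R; last by rewrite cs mul1r addrA.
  by rewrite ac bc; ring.
transitivity (q + (c ^+ 2 + s ^+ 2) * (z ^+ 2 + w ^+ 2))%R; last by rewrite cs mul1r addrA.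
by ring.
Qed.

End planar.

(** * Positive definiteness of the overlap kernels *)

Section ball_kernel.
Local Open Scope ereal_scope.
Context {R : realType}.
Local Notation mu := (@lebesgue_measure R).
Implicit Types (f : R -> \bar R) (W : R -> R).

(** A class stable under [marginal] that still allows a singularity at the origin but keeps overlap
    integrals with positive shifts finite. *)
Definition tame f : Prop :=
  [/\ measurable_fun setT f, forall x, 0 <= f x,
      forall x, (1 <= x)%R -> f x = 0 &
      forall e, (0 < e)%R -> exists B : R, forall x, (e <= x)%R -> f x <= B%:E].

Lemma integral_unit_bound (g : R -> \bar R) (B : R) :
  measurable_fun setT g -> (forall z, 0 <= g z) ->
  (forall z, g z <= B%:E) -> (forall z, (1 <= z ^+ 2)%R -> g z = 0) ->
  \int[mu]_z g z <= (2 * B)%:E.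
Proof.
move=> mg g0 gB gs.
have B0 : (0 <= B)%R by rewrite -lee_fin (le_trans (g0 0%R)).
apply: (@le_trans _ _ (\int[mu]_z (B * \1_(`[(-1)%R, 1%R]%classic : set R) z)%:E)).
  apply: ge0_le_integral => //.
  - by apply/measurable_EFinP; apply: measurable_funM => //; exact: measurable_indic.
  move=> z _; have [z1|z1] := leP 1%R (z ^+ 2)%R.
    by rewrite gs// lee_fin mulr_ge0.
  rewrite indicE mem_set ?mulr1//= in_itv/= -ler_norml.
  by rewrite -(@expr_le1 _ 2)// real_normK ?num_real// ltW.
under eq_integral do rewrite EFinM.
rewrite ge0_integralZl_EFin//; last exact/measurable_EFinP/measurable_indic.
rewrite integral_indic//= setIT lebesgue_measure_itv/= lte_fin ifT; last lra.
by rewrite -EFinD -EFinM lee_fin; lra.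
Qed.

Lemma tame_marginal f : tame f -> tame (marginal f).
Proof.
move=> [mf f0 fs fb]; split.
- exact: measurable_marginal.
- by move=> x; exact: marginal_ge0.
- move=> x x1; apply: integral0_eq => z _; apply: fs.
  by rewrite (le_trans x1)// lerDl sqr_ge0.
- move=> e e0; have [B fB] := fb _ e0; exists (2 * B)%R => x ex.
  apply: integral_unit_bound => //.
  + by apply: (measurableT_comp mf); meas.
  + by move=> z; apply: fB; rewrite (le_trans ex)// lerDl sqr_ge0.
  + move=> z z1; apply: fs; rewrite (le_trans z1)// lerDr (le_trans _ ex)// ltW//.
Qed.

Lemma tame_iter_marginal f d : tame f -> tame (iter d marginal f).
Proof. by move=> tf; elim: d => //= d; exact: tame_marginal. Qed.

Lemma lens_lty f p q r : tame f -> (0 < p)%R -> (0 < q)%R -> lens f p q r < +oo.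
Proof.
move=> [mf f0 fs fb] p0 q0.
have [B fB] := fb _ q0; apply: (@le_lt_trans _ _ (2 * B)%:E); last exact: ltry.
apply: integral_unit_bound => //.
- by apply: (measurableT_comp mf); meas.
- by move=> z; apply: fB; rewrite le_max lerDl sqr_ge0 orbT.
- by move=> z z1; apply: fs; apply: (le_trans z1); rewrite le_max [X in _ || X]lerDr (ltW q0) orbT.

Qed.

(** The offset may be a signed coordinate difference; reflecting [z] removes the sign. *)
Lemma lens_sqr f p q r a : measurable_fun setT f -> (forall x, 0 <= f x) ->
  (r ^+ 2 = a ^+ 2)%R -> lens f p q r = lens f p q a.
Proof.
move=> mf f0 /eqP; rewrite eqf_sqr => /orP[/eqP -> //|/eqP ->].
rewrite /lens -[RHS]integral_oppr//.
  by apply: eq_integral => z _; congr (f (Num.max _ _)); ring.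
by apply: (measurableT_comp mf); meas.
Qed.

(* The argument is a squared distance; values at [x <= 0] are unconstrained,
   which leaves room for profiles that blow up at the origin. *)
Definition profile W : Prop :=
  [/\ forall x, (0 <= W x)%R,
      measurable_fun setT W,
      forall x, (1 <= x)%R -> W x = 0%R &
      forall x y, (0 < x)%R -> (x <= y)%R -> (W y <= W x)%R].

Lemma tame_profile W : profile W -> tame (EFin \o W).
Proof.
move=> [W0 mW Ws Wd]; split.
- exact/measurable_EFinP.
- by move=> x; rewrite lee_fin.
- by move=> x x1 /=; rewrite Ws.
- by move=> e e0; exists (W e) => x ex; rewrite lee_fin Wd.
Qed.

(* For [x], [y] in R^d with [|x - y| = r], this is the integral over R^d of
   [min (W (p + |x - z|^2)) (W (q + |y - z|^2))], reduced to a line by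
   rotation invariance. *)
Definition ball_kernel W d p q r : \bar R :=
  if d is d'.+1 then lens (iter d' marginal (EFin \o W)) p q r
  else (W (Num.max p q))%:E.

Lemma ball_kernel_lty W d p q r : profile W -> (0 < p)%R -> (0 < q)%R ->
  ball_kernel W d p q r < +oo.
Proof.
move=> pW p0 q0; case: d => [|d] /=; first exact: ltry.
by apply: lens_lty => //; apply/tame_iter_marginal/tame_profile.
Qed.

Lemma ball_kernel_ge0 W d p q r : profile W -> 0 <= ball_kernel W d p q r.
Proof.
move=> pW; have [W0 _ _ _] := pW; case: d => [|d] /=; first by rewrite lee_fin.
by apply: lens_ge0; case: (tame_iter_marginal d (tame_profile pW)).
Qed.

Lemma measurable_ball_kernel W d (p q : R -> R) r : profile W ->
  measurable_fun setT p -> measurable_fun setT q ->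
  measurable_fun setT (fun z => ball_kernel W d (p z) (q z) r).
Proof.
move=> pW mp mq; have [W0 mW _ _] := pW; case: d => [|d] /=.
  by apply/measurable_EFinP/(measurableT_comp mW); exact: measurable_maxr.
have [mf f0 _ _] := tame_iter_marginal d (tame_profile pW).
by apply: measurable_lens.
Qed.

(** By Pythagoras, [r] splits into an offset [a] in the new coordinate and a distance [b] in the
    first [d]. For [d = 0] the kernel ignores its distance argument, hence the condition on [b]. *)
Lemma ball_kernel_rec W d p q a b r : profile W ->
  (r ^+ 2 = a ^+ 2 + b ^+ 2)%R -> (d = 0%N -> b = 0%R) ->
  \int[mu]_z ball_kernel W d (p + (z - a) ^+ 2)%R (q + z ^+ 2)%R b =
  ball_kernel W d.+1 p q r.
Proof.
move=> pW rab; case: d => [|d] b0 /=.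
  have [mf f0 _ _] := tame_profile pW.
  by rewrite (@lens_sqr _ p q r a)// rab b0// expr0n addr0.
have [mf f0 _ _] := tame_iter_marginal d (tame_profile pW).
exact: lens_planar.
Qed.

(** The minimum is the length of the intersection of [[0, w i[] and [[0, w j[], hence a Gram matrix
    of indicators. *)
Lemma psd_minr (I : finType) (w : I -> R) : (forall i, 0 <= w i)%R ->
  psd (fun i j => Num.min (w i) (w j)).
Proof.
move=> w0.
pose k (t : R) i j := (\1_(`[0%R, w i[%classic : set R) t * \1_(`[0%R, w j[%classic : set R) t)%R : R.
have kE i j : \int[mu]_t (k t i j)%:E = (Num.min (w i) (w j))%:E.
  rewrite -[LHS]/(\int[mu]_t (k t i j)%:E).
  transitivity (\int[mu]_t (\1_(`[0%R, Num.min (w i) (w j)[%classic : set R) t)%:E).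
    apply: eq_integral => t _; rewrite /k !indicE -natrM mulnb !mem_setE !in_itv/= lt_min.
    by case: (0 <= t)%R.
  rewrite integral_indic//= setIT lebesgue_measure_itv/= lte_fin.
  case: ifPn; first by rewrite sube0.
  rewrite -leNgt => wle; congr (_%:E); apply/eqP.
  by rewrite eq_le wle le_min !w0.
have : psd (fun i j => fine (\int[mu]_t (k t i j)%:E)).
  apply: psd_integral.
  - by move=> t; apply: psd_rank1.
  - by move=> t i j; rewrite mulr_ge0.
  - by move=> i j; apply: measurable_funM; exact: measurable_indic.
  - by move=> i j; rewrite kE ltry.
rewrite /psd => H c; have := H c; congr (_ <= _)%R.
by apply: eq_bigr => i _; apply: eq_bigr => j _; rewrite kE.
Qed.

(** Points are sequences of which only the first [d] coordinates count, so that an induction on [d]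
    keeps the same points. *)
Definition dist d (x y : nat -> R) : R :=
  Num.sqrt (\sum_(k < d) (x k - y k) ^+ 2).

(** For fixed last coordinate [z] of the integration variable, the contributions [(z - x i d) ^ 2]
    are absorbed into the shifts. This is why the shifts depend on [i] and are general in the
    induction on [d]. *)
Lemma psd_ball_kernel W d (I : finType) (x : I -> nat -> R) (p : I -> R) :
  profile W -> (forall i, 0 < p i)%R ->
  psd (fun i j => fine (ball_kernel W d (p i) (p j) (dist d (x i) (x j)))).
Proof.
move=> pW; elim: d p => [|d IH] p p0.
  have [W0 _ _ Wd] := pW.
  have := psd_minr (fun i => W0 (p i)); rewrite /psd => H c; have := H c.
  congr (_ <= _)%R; apply: eq_bigr => i _; apply: eq_bigr => j _ /=; congr (_ * _)%R.
  by case: (leP (p i) (p j)) => [pij|/ltW pij]; [apply/min_idPr|apply/min_idPl]; exact: Wd.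
pose k z i j := fine (ball_kernel W d (p i + (z - x i d) ^+ 2)%R
  (p j + (z - x j d) ^+ 2)%R (dist d (x i) (x j))).
have pz i z : (0 < p i + (z - x i d) ^+ 2)%R by rewrite ltr_wpDr// sqr_ge0.
have kE i j : \int[mu]_z (k z i j)%:E = ball_kernel W d.+1 (p i) (p j) (dist d.+1 (x i) (x j)).
  rewrite -(@ball_kernel_rec W d (p i) (p j) (x i d - x j d) (dist d (x i) (x j)))//; last 2 first.
  - rewrite !sqr_sqrtr; try by apply: sumr_ge0 => ? _; exact: sqr_ge0.
    by rewrite big_ord_recr/= addrC.
  - by move=> ->; rewrite /dist big_ord0 sqrtr0.
  rewrite -[RHS](@integral_translate _ _ (- x j d)); last 2 first.
  - by apply: measurable_ball_kernel => //; meas.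
  - by move=> z; exact: ball_kernel_ge0.
  apply: eq_integral => z _; rewrite /k fineK; last first.
    by rewrite ge0_fin_numE ?ball_kernel_ge0// ball_kernel_lty.
  by congr ball_kernel; ring.
have : psd (fun i j => fine (\int[mu]_z (k z i j)%:E)).
  apply: psd_integral.
  - by move=> t; exact: IH.
  - by move=> t i j; rewrite fine_ge0// ball_kernel_ge0.
  - move=> i j; apply: (measurableT_comp (fine_measurable measurableT)).
    by apply: measurable_ball_kernel => //; meas.
  - by move=> i j; rewrite kE ball_kernel_lty.
rewrite /psd => H c; have := H c; congr (_ <= _)%R.
by apply: eq_bigr => i _; apply: eq_bigr => j _; rewrite kE.
Qed.

End ball_kernel.

(** * Integrating out two coordinates *)
Section double_step.
Local Open Scope ereal_scope.
Context {R : realType}.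
Local Notation mu := (@lebesgue_measure R).
Implicit Types (f : R -> \bar R) (W : R -> R).

Lemma integral_even f : measurable_fun setT f -> (forall x, 0 <= f x) ->
  (forall x, f (- x)%R = f x) ->
  \int[mu]_x f x = 2%:E * \int[mu]_(x in `[0%R, +oo[) f x.
Proof.
move=> mf f0 ef.
have -> : [set: R] = `]-oo, 0%R[ `|` `[0%R, +oo[.
  by apply/seteqP; split=> x //= _; rewrite !in_itv/= andbT; case: (ltP x 0%R); [left|right].
rewrite ge0_integral_setU//=; last 2 first.
- exact: measurable_funTS.
- apply/disj_setPS => x [] /=; rewrite !in_itv/= andbT => x0 x1.
  by move: (lt_le_trans x0 x1); rewrite ltxx.
have -> : \int[mu]_(x in `]-oo, 0%R[) f x = \int[mu]_(x in `]-oo, 0%R]) f x.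
  by apply: integral_itv_bndo_bndc; exact: measurable_funTS.
rewrite (_ : \int[mu]_(x in `]-oo, 0%R]) f x = \int[mu]_(x in `[0%R, +oo[) f x).
  by rewrite -mule2n -mule_natl.
rewrite ge0_integration_by_substitution0//.
by apply: eq_integral => x _; rewrite ef.
Qed.

Lemma integral_oneDsqr : \int[mu]_x ((1 + x ^+ 2)^-1)%:E = (pi : R)%:E.
Proof.
rewrite integral_even.
- have := @integral0y_oneDsqr R; rewrite /oneDsqr => ->.
  by rewrite -EFinM; congr EFin; field.
- by apply/measurable_EFinP; apply: continuous_measurable_fun; exact: continuous_oneDsqrV.
- by move=> x; rewrite lee_fin invr_ge0 addr_ge0// sqr_ge0.
- by move=> x; rewrite sqrrN.
Qed.

(* Polar coordinates without angles: substitute [w = z t] in the inner integral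
   and exchange, which leaves [\int 1 / (1 + t ^ 2) = pi] as a factor. *)
Lemma marginal_marginal f p : measurable_fun setT f -> (forall x, 0 <= f x) ->
  marginal (marginal f) p = pi%:E * \int[mu]_(z in `[0%R, +oo[) ((2 * z)%:E * f (p + z ^+ 2)%R).
Proof.
move=> mf f0.
pose g z := (`|z|)%:E * f (p + z ^+ 2)%R.
have mz2 : measurable_fun setT (fun z : R => f (p + z ^+ 2)%R).
  by apply: (measurableT_comp mf); meas.
have mg : measurable_fun setT g.
  by apply: emeasurable_funM => //; apply/measurable_EFinP; exact: normr_measurable.
have g0 z : 0 <= g z by rewrite mule_ge0.
pose G z t := (`|z|)%:E * f (p + z ^+ 2 * (1 + t ^+ 2))%R.
have mG : measurable_fun setT (fun z : R * R => G z.1 z.2).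
  apply: emeasurable_funM.
    by apply/measurable_EFinP; apply: (measurableT_comp (@normr_measurable R setT)); exact: measurable_fst.
  by apply: (measurableT_comp mf); meas.
have G0 z t : 0 <= G z t by rewrite mule_ge0.
transitivity (\int[mu]_z \int[mu]_t G z t).
  (* The substitution [w = z t] needs [z != 0]; a single point is negligible. *)
  rewrite /marginal -[LHS](@integral_setD1 _ _ 0%R); last 2 first.
  - exact: measurableD.
  - apply: measurable_funTS; apply: (measurableT_comp (measurable_marginal mf f0)); meas.
  rewrite -[RHS](@integral_setD1 _ _ 0%R); last 2 first.
  - exact: measurableD.
  - by apply: measurable_funTS; exact: measurable_integral_param.
  apply: eq_integral => z /[!inE] -[_ /= z0].
  have z0' : (0 < `|z|)%R by rewrite normr_gt0; apply/eqP.
  have mw : measurable_fun setT (fun w : R => f (p + z ^+ 2 + w ^+ 2)%R).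
    by apply: (measurableT_comp mf); meas.
  rewrite -(integral_scale z0' mw)//.
  rewrite -ge0_integralZl_EFin//; last first.
    by apply: (measurableT_comp mf); meas.
  apply: eq_integral => t _; rewrite /G; congr (_ * f _)%E.
  by rewrite exprMn real_normK ?num_real//; ring.
rewrite tonelli_line//.
transitivity (\int[mu]_t (((1 + t ^+ 2)^-1)%:E * \int[mu]_z g z)).
  apply: eq_integral => t _.
  have t1 : (0 < 1 + t ^+ 2)%R by rewrite ltr_pwDl// sqr_ge0.
  (* Rescaling [z] by [a] separates the variables and leaves the factor [1 / (1 + t ^ 2)]. *)
  pose a := Num.sqrt (1 + t ^+ 2)%R.
  have a0 : (0 < a)%R by rewrite sqrtr_gt0.
  have a2 : (a ^+ 2 = 1 + t ^+ 2)%R by rewrite sqr_sqrtr// ltW.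
  rewrite -(integral_scale a0 mg)// muleA -EFinM -ge0_integralZl_EFin//; last 2 first.
  - by apply: (measurableT_comp mg); meas.
  - by rewrite mulr_ge0 ?invr_ge0 ?ltW.
  apply: eq_integral => z _; rewrite /g /G muleA -EFinM; congr (_%:E * f _)%E.
    by rewrite normrM gtr0_norm// !mulrA -a2; field; rewrite gt_eqF.
  by rewrite exprMn a2 mulrC.
rewrite ge0_integralZr//; last 3 first.
- by apply/measurable_EFinP; apply: continuous_measurable_fun; exact: continuous_oneDsqrV.
- by move=> t _; rewrite lee_fin invr_ge0 addr_ge0// sqr_ge0.
- by apply: integral_ge0.
rewrite integral_oneDsqr; congr (_ * _).
rewrite integral_even//; last by move=> z; rewrite /g normrN sqrrN.
rewrite -ge0_integralZl_EFin//; last exact: measurable_funTS.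
apply: eq_integral => z /[!inE]; rewrite /= in_itv/= andbT => z0.
by rewrite /g muleA -EFinM ger0_norm.
Qed.

End double_step.

(** * Powers of the positive part *)

Section pos_part_power.
Context {R : realType}.
Local Notation mu := (@lebesgue_measure R).
Implicit Types (x t : R).

Definition pos_pow (k x : R) : R := (Num.max x 0) `^ k.

Lemma pos_pow_ge0 k x : 0 <= pos_pow k x.
Proof. exact: powR_ge0. Qed.

Lemma pos_powE k x : 0 <= x -> pos_pow k x = x `^ k.
Proof. by move=> x0; rewrite /pos_pow max_l. Qed.

Lemma pos_pow_homo k x y : 0 <= k -> x <= y -> pos_pow k x <= pos_pow k y.
Proof.
move=> k0 xy; apply: ge0_ler_powR; rewrite // ?nnegrE.
- by rewrite le_max lexx orbT.
- by rewrite le_max lexx orbT.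
- by rewrite ge_max !le_max xy lexx orbT.
Qed.

Lemma measurable_pos_pow k : measurable_fun setT (pos_pow k).
Proof.
apply: (measurableT_comp (measurable_powR k)); exact: measurable_maxr.
Qed.

Lemma continuous_pos_pow k : 0 <= k -> continuous (pos_pow k).
Proof.
rewrite le_eqVlt => /predU1P[<-|k0].
  have -> : pos_pow 0 = cst 1 by apply/funext => x; rewrite /pos_pow powRr0.
  by move=> x; exact: cvg_cst.
move=> x; have [x0|x0|->] := ltgtP x 0.
- rewrite /continuous_at.
  have -> : pos_pow k x = 0 by rewrite /pos_pow max_r ?ltW// powR0// gt_eqF.
  apply: cvg_near_cst; near=> y.
  rewrite /pos_pow max_r ?powR0 ?gt_eqF//; apply: ltW; near: y; exact: lt_nbhsl.
- rewrite /continuous_at (pos_powE k (ltW x0)).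
  have cx : {for x, continuous (fun y : R => y `^ k)}.
    apply: differentiable_continuous; apply/derivable1_diffP.
    by apply: ex_derive; exact: is_derive1_powR.
  apply: cvg_trans cx.
  apply: near_eq_cvg; near=> y.
  rewrite pos_powE//; apply: ltW; near: y; exact: lt_nbhsr.
- apply/cvgrPdist_lt => e e0; rewrite pos_powE// powR0 ?gt_eqF//.
  near=> y; rewrite sub0r normrN ger0_norm ?pos_pow_ge0//.
  (* Write [e] as the [k]-th power of its [k]-th root and compare the bases. *)
  rewrite -[ltRHS]powRr1 ?ltW// -(mulVf (lt0r_neq0 k0)) powRrM.
  apply: gt0_ltr_powR; rewrite // ?nnegrE ?powR_ge0//.
    by rewrite le_max lexx orbT.
  rewrite gt_max powR_gt0// andbT.
  near: y; apply: lt_nbhsl; exact: powR_gt0.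
Unshelve. all: by end_near. Qed.

Lemma is_derive_pos_pow k x : 0 < x -> is_derive x 1 (pos_pow k) (k * pos_pow (k - 1) x).
Proof.
move=> x0; rewrite (pos_powE _ (ltW x0)).
apply: near_eq_is_derive (is_derive1_powR k x0).
near=> y; rewrite pos_powE//; apply: ltW; near: y; exact: lt_nbhsr.
Unshelve. all: by end_near. Qed.

End pos_part_power.

(** * Profiles whose iterated marginals are prescribed *)

Section iterated_profile.
Local Open Scope ereal_scope.
Context {R : realType}.
Local Notation mu := (@lebesgue_measure R).
Implicit Types (f g : R -> \bar R) (W h : R -> R).

Lemma marginalD f g : measurable_fun setT f -> (forall x, 0 <= f x) ->
  measurable_fun setT g -> (forall x, 0 <= g x) ->
  marginal (fun x => f x + g x) = (fun x => marginal f x + marginal g x).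
Proof.
move=> mf f0 mg g0; apply/funext => x; rewrite /marginal ge0_integralD//.
- by apply: (measurableT_comp mf); meas.
- by apply: (measurableT_comp mg); meas.
Qed.

Lemma marginalZ f (k : R) : (0 <= k)%R -> measurable_fun setT f -> (forall x, 0 <= f x) ->
  marginal (fun x => k%:E * f x) = (fun x => k%:E * marginal f x).
Proof.
move=> k0 mf f0; apply/funext => x; rewrite /marginal ge0_integralZl_EFin//.
by apply: (measurableT_comp mf); meas.
Qed.

Lemma iter_marginalD f g n : tame f -> tame g ->
  iter n marginal (fun x => f x + g x) = (fun x => iter n marginal f x + iter n marginal g x).
Proof.
move=> tf tg; elim: n => //= n ->.
have [mf f0 _ _] := tame_iter_marginal n tf; have [mg g0 _ _] := tame_iter_marginal n tg.
exact: marginalD.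
Qed.

Lemma iter_marginalZ f (k : R) n : (0 <= k)%R -> tame f ->
  iter n marginal (fun x => k%:E * f x) = (fun x => k%:E * iter n marginal f x).
Proof.
move=> k0 tf; elim: n => //= n ->.
have [mf f0 _ _] := tame_iter_marginal n tf.
exact: marginalZ.
Qed.

Lemma profileD W1 W2 : profile W1 -> profile W2 -> profile (fun x => W1 x + W2 x)%R.
Proof.
move=> [W10 mW1 W1s W1d] [W20 mW2 W2s W2d]; split.
- by move=> x; rewrite addr_ge0.
- exact: measurable_funD.
- by move=> x x1; rewrite W1s// W2s// addr0.
- by move=> x y x0 xy; rewrite lerD ?W1d ?W2d.
Qed.

Lemma profileZ W (k : R) : (0 <= k)%R -> profile W -> profile (fun x => k * W x)%R.
Proof.
move=> k0 [W0 mW Ws Wd]; split.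
- by move=> x; rewrite mulr_ge0.
- exact: measurable_funM.
- by move=> x x1; rewrite Ws// mulr0.
- by move=> x y x0 xy; rewrite ler_wpM2l ?Wd.
Qed.

(* The factor [pi ^+ k] makes [h] the [k]-fold primitive of [W] in the squared
   distance. *)
Definition is_marginal k h : Prop := exists W, profile W /\
  forall p, (0 < p)%R -> iter k.*2 marginal (EFin \o W) p = (pi ^+ k * h p)%:E.

Lemma is_marginalD k h1 h2 : is_marginal k h1 -> is_marginal k h2 -> is_marginal k (fun x => h1 x + h2 x)%R.
Proof.
move=> [W1 [pW1 W1h]] [W2 [pW2 W2h]]; exists (fun x => W1 x + W2 x)%R.
split; first exact: profileD.
move=> p p0.
rewrite (_ : EFin \o _ = fun x => (EFin \o W1) x + (EFin \o W2) x)//.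
rewrite iter_marginalD; [|exact: tame_profile|exact: tame_profile].
by rewrite W1h// W2h// mulrDr.
Qed.

Lemma is_marginalZ k h (c : R) : (0 <= c)%R -> is_marginal k h -> is_marginal k (fun x => c * h x)%R.
Proof.
move=> c0 [W [pW Wh]]; exists (fun x => c * W x)%R.
split; first exact: profileZ.
move=> p p0.
rewrite (_ : EFin \o _ = fun x => c%:E * (EFin \o W) x)//.
rewrite iter_marginalZ//; last exact: tame_profile.
by rewrite Wh// -EFinM mulrCA.
Qed.

(** With [u = p + z ^ 2], the integral hypothesis says that [H p] is the integral of [h] over
    [u > p]. By [marginal_marginal], this is two marginals up to one factor [pi]. *)
Lemma is_marginalS k h H : measurable_fun setT h -> (forall x, (0 <= h x)%R) ->
  (forall p, (0 < p)%R ->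
    \int[mu]_(z in `[0%R, +oo[) (2 * z * h (p + z ^+ 2))%:E = (H p)%:E) ->
  is_marginal k h -> is_marginal k.+1 H.
Proof.
move=> mh h0 hH [W [pW Wh]]; exists W; split => // p p0.
have [mf f0 _ _] := tame_iter_marginal k.*2 (tame_profile pW).
rewrite doubleS /= marginal_marginal// exprS.
transitivity (pi%:E * \int[mu]_(z in `[0%R, +oo[) ((pi ^+ k)%:E * (2 * z * h (p + z ^+ 2)%R)%:E)).
  congr (_ * _); apply: eq_integral => z /[!inE]; rewrite /= in_itv/= andbT => z0.
  by rewrite Wh ?ltr_wpDr ?sqr_ge0// -!EFinM; congr EFin; ring.
rewrite ge0_integralZl_EFin//.
- by rewrite hH// -!EFinM mulrA.
- move=> z; rewrite /= in_itv/= andbT => z0; by rewrite lee_fin !mulr_ge0.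
- apply/measurable_EFinP/measurable_funTS; apply: measurable_funM; first by meas.
  by apply: (measurableT_comp mh); meas.
- by rewrite exprn_ge0// pi_ge0.
Qed.

End iterated_profile.

(** * A family closed under differentiation in the squared distance *)

Section monomial.
Context {R : realType}.
Variables (v b : R).
Hypotheses (v0 : 0 < v) (b0 : 0 <= b).
Local Notation mu := (@lebesgue_measure R).
Implicit Types (x t k a c : R).

(** The last factor is trivial for [cap], which serves odd dimensions, and is used by [slice] in
    even ones. *)
Definition mono k a c t : R := pos_pow k (1 - t) * (t `^ (- a) * (v + b * t) `^ (- c)).

(** Read in the squared distance. The cut matters at [k = 0], where [pos_pow k] is the constant 1
    because zero to the power zero is 1. *)
Definition cut_mono k a c q : R := if q < 1 then mono k a c (Num.sqrt q) else 0.

Lemma mono_ge0 k a c t : 0 <= mono k a c t.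
Proof. by rewrite !mulr_ge0 ?powR_ge0. Qed.

Lemma cut_mono_ge0 k a c q : 0 <= cut_mono k a c q.
Proof. by rewrite /cut_mono; case: ifP => // _; exact: mono_ge0. Qed.

Lemma powRN_homo a x y : 0 <= a -> 0 < x -> x <= y -> y `^ (- a) <= x `^ (- a).
Proof.
move=> a0 x0 xy; have y0 := lt_le_trans x0 xy.
rewrite !powRN lef_pV2 ?posrE ?powR_gt0//.
by apply: ge0_ler_powR => //; rewrite nnegrE ltW.
Qed.

Lemma measurable_mono k a c : measurable_fun setT (mono k a c).
Proof.
apply: measurable_funM.
  by apply: (measurableT_comp (measurable_pos_pow k)); meas.
apply: measurable_funM; first exact: measurable_powR.
by apply: (measurableT_comp (measurable_powR _)); meas.
Qed.

Lemma measurable_cut_mono k a c : measurable_fun setT (cut_mono k a c).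
Proof.
apply: measurable_fun_ifT => //; first exact: measurable_fun_ltr.
apply: (measurableT_comp (measurable_mono k a c)).
by apply: continuous_measurable_fun; exact: sqrt_continuous.
Qed.

Lemma profile_cut_mono k a c : 0 <= k -> 0 <= a -> 0 <= c -> profile (cut_mono k a c).
Proof.
move=> k0 a0 c0; split.
- exact: cut_mono_ge0.
- exact: measurable_cut_mono.
- by move=> x; rewrite leNgt /cut_mono => /negbTE ->.
- move=> x y x0 xy; rewrite /cut_mono; case: ifPn => y1; last by rewrite -/(cut_mono k a c x) cut_mono_ge0.
  rewrite (le_lt_trans xy y1).
  have sx : 0 < Num.sqrt x by rewrite sqrtr_gt0.
  have sxy : Num.sqrt x <= Num.sqrt y by rewrite ler_wsqrtr.
  apply: ler_pM => //.
  + by rewrite pos_pow_ge0.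
  + by rewrite mulr_ge0 ?powR_ge0.
  + by apply: pos_pow_homo => //; rewrite lerB.
  + apply: ler_pM; rewrite ?powR_ge0//; first exact: powRN_homo.
    by apply: powRN_homo => //; [rewrite ltr_pwDl// mulr_ge0// ltW|rewrite lerD2l ler_wpM2l].
Qed.

(* [dmono] is [- mono^`() / (2 t)], that is minus the derivative with respect
   to [t ^+ 2]; its coefficients are nonnegative. *)
Definition dmono k a c t : R := 2^-1 * (k * mono (k - 1) (a + 1) c t)
  + (2^-1 * (a * mono k (a + 2) c t) + 2^-1 * (b * c * mono k (a + 1) (c + 1) t)).

(** Spelled out as a combination of [cut_mono], to which [is_marginalD] and [is_marginalZ] apply;
    [cut_dmonoE] gives the analytic reading. *)
Definition cut_dmono k a c q : R := 2^-1 * (k * cut_mono (k - 1) (a + 1) c q)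
  + (2^-1 * (a * cut_mono k (a + 2) c q) + 2^-1 * (b * c * cut_mono k (a + 1) (c + 1) q)).

Lemma cut_dmonoE k a c q : cut_dmono k a c q = if q < 1 then dmono k a c (Num.sqrt q) else 0.
Proof. by rewrite /cut_dmono /cut_mono /dmono; case: ifP => // _; rewrite !mulr0 !addr0. Qed.

Lemma mulr_powRN t a : 0 < t -> t * t `^ (- (a + 1)) = t `^ (- a).
Proof.
move=> t0; have tn0 : t != 0 by rewrite gt_eqF.
rewrite -{1}[t]powRr1 ?ltW// -powRD ?tn0 ?implybT//.
by congr (_ `^ _); ring.
Qed.

Lemma is_derive_mono k a c t : 0 < t -> t < 1 ->
  is_derive t 1 (mono k a c) (- (2 * t * dmono k a c t)).
Proof.
move=> t0 t1.
have t1' : 0 < 1 - t by rewrite subr_gt0.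
have vbt : 0 < v + b * t by rewrite ltr_pwDl// mulr_ge0// ltW.
have d1 : is_derive t 1 (fun t => pos_pow k (1 - t)) (k * pos_pow (k - 1) (1 - t) * -1).
  have dl : is_derive t 1 (fun t : R => 1 - t) (-1).
    by have := is_deriveB (is_derive_cst (1 : R) t (1 : R)) (is_derive_id t (1 : R));
      rewrite sub0r.
  exact: (@is_derive1_comp _ (pos_pow k) (fun t => 1 - t) t _ _ (is_derive_pos_pow k t1') dl).
have d2 : is_derive t 1 (fun t => t `^ (- a)) (- a * t `^ (- a - 1)).
  exact: is_derive1_powR.
have d3 : is_derive t 1 (fun t => (v + b * t) `^ (- c)) (- c * (v + b * t) `^ (- c - 1) * b).
  have dl : is_derive t 1 (fun t : R => v + b * t) b.
    have := is_deriveD (is_derive_cst v t (1 : R)) (is_deriveZ b (is_derive_id t (1 : R))).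
    by rewrite add0r -[b *: 1]/(b * 1) mulr1.
  exact: (@is_derive1_comp _ (fun x => x `^ (- c)) (fun t => v + b * t) t _ _ (is_derive1_powR (- c) vbt) dl).
have d := is_deriveM d1 (is_deriveM d2 d3).
apply: (is_derive_eq (f := mono k a c) d).
rewrite -![_ *: _]/(_ * _) /dmono /mono.
(* Reducing all powers of [t] to the exponent [- (a + 2)] leaves a rational identity. *)
have e1 : t `^ (- a) = t * t `^ (- (a + 1)) by rewrite mulr_powRN.
have e2 : t `^ (- (a + 1)) = t * t `^ (- (a + 2)).
  have -> : a + 2 = a + 1 + 1 by ring.
  by rewrite mulr_powRN.
have -> : - a - 1 = - (a + 1) by ring.
have -> : - c - 1 = - (c + 1) by ring.
by rewrite mulrfctE e1 e2; field.
Qed.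

Lemma continuous_mono k a c t : 0 <= k -> 0 < t -> {for t, continuous (mono k a c)}.
Proof.
move=> k0 t0.
have vbt : 0 < v + b * t by rewrite ltr_pwDl// mulr_ge0// ltW.
have cp x e : 0 < x -> {for x, continuous (fun y : R => y `^ e)}.
  move=> x0; apply: differentiable_continuous; apply/derivable1_diffP.
  by apply: ex_derive; exact: is_derive1_powR.
apply: cvgM.
  apply: (@continuous_comp _ _ _ (fun t => 1 - t) (pos_pow k)); last exact: continuous_pos_pow.
  by apply: cvgB; [exact: cvg_cst|exact: cvg_id].
apply: cvgM; first exact: cp.
apply: (@continuous_comp _ _ _ (fun t => v + b * t) (fun y => y `^ (- c))); last exact: cp.
by apply: cvgD; [exact: cvg_cst|apply: cvgM; [exact: cvg_cst|exact: cvg_id]].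
Qed.

Lemma continuous_dmono k a c t : 1 <= k -> 0 < t -> {for t, continuous (dmono k a c)}.
Proof.
move=> k1 t0; have k0 : 0 <= k - 1 by rewrite subr_ge0.
have k0' : 0 <= k := le_trans ler01 k1.
by apply: cvgD; [|apply: cvgD]; do 2 (apply: cvgM; first exact: cvg_cst); exact: continuous_mono.
Qed.

(** Fundamental theorem of calculus for [- mono (sqrt (p + z ^ 2))] on [[0, e]], where
    [p + e ^ 2 = 1]. That [k >= 1] makes the integrand continuous up to [e] and the boundary term
    there zero. *)
Lemma integral_cut_dmono k a c p : 1 <= k -> 0 <= a -> 0 <= c -> 0 < p ->
  (\int[mu]_(z in `[0%R, +oo[) (2 * z * cut_dmono k a c (p + z ^+ 2))%:E = (cut_mono k a c p)%:E)%E.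
Proof.
move=> k1 a0 c0 p0.
have k0 : 0 <= k := le_trans ler01 k1.
have [p1|p1] := leP 1 p.
  rewrite /cut_mono ltNge p1/= integral0_eq// => z _.
  by rewrite cut_dmonoE ltNge (le_trans p1) ?lerDl ?sqr_ge0// mulr0.
pose e := Num.sqrt (1 - p).
have e0 : 0 < e by rewrite sqrtr_gt0 subr_gt0.
have e2 : p + e ^+ 2 = 1 by rewrite sqr_sqrtr ?subr_ge0 ?ltW//; ring.
have lt1E z : 0 <= z -> (p + z ^+ 2 < 1) = (z < e).
  by move=> z0; rewrite -e2 ltrD2l ltr_pXn2r// nnegrE ltW.
pose T z := Num.sqrt (p + z ^+ 2).
have pz z : 0 < p + z ^+ 2 by rewrite ltr_wpDr// sqr_ge0.
have T0 z : 0 < T z by rewrite sqrtr_gt0.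
have T2 z : T z ^+ 2 = p + z ^+ 2 by rewrite sqr_sqrtr// ltW.
have cT : continuous T.
  have cq : continuous (fun z : R => p + z ^+ 2).
    by move=> z; apply: cvgD; [exact: cvg_cst|exact: exprn_continuous].
  by move=> z; exact: (continuous_comp (cq z) (@sqrt_continuous R _)).
have md : measurable_fun setT (dmono k a c).
  by apply: measurable_funD; [|apply: measurable_funD]; do 2 (apply: measurable_funM => //); exact: measurable_mono.
have dF z : z \in `]0, e[ -> is_derive z 1 (fun z => - mono k a c (T z)) (2 * z * dmono k a c (T z)).
  rewrite in_itv/= => /andP[z0 ze].
  have T1 : T z < 1 by rewrite -(@expr_lt1 _ 2)// ?ltW// T2 lt1E// ltW.
  have dq : is_derive z 1 (fun z : R => p + z ^+ 2) (2 * z).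
    have := is_deriveD (is_derive_cst p z (1 : R)) (is_deriveX 2 (is_derive_id z (1 : R))).
    by rewrite add0r expr1 -[_ *: _]/(_ * _) mulr1.
  have dT := @is_derive1_comp _ Num.sqrt (fun z : R => p + z ^+ 2) z _ _ (is_derive1_sqrt (pz z)) dq.
  have dm := is_deriveN (@is_derive1_comp _ (mono k a c) T z _ _ (is_derive_mono k a c (T0 z) T1) dT).
  apply: is_derive_eq dm _; rewrite -/(T z).
  by field; rewrite gt_eqF.
transitivity (\int[mu]_(z in `[0%R, e[) (2 * z * dmono k a c (T z))%:E)%E.
  rewrite integral_mkcond [RHS]integral_mkcond; apply: eq_integral => z _.
  rewrite !patchE !mem_setE !in_itv/= andbT.
  have [z0/=|//] := leP 0 z.
  rewrite cut_dmonoE lt1E//; case: ifP => // _.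
  by rewrite mulr0.
rewrite integral_itv_bndo_bndc; last first.
  apply/measurable_EFinP/measurable_funTS; apply: measurable_funM; first by meas.
  apply: (measurableT_comp md); exact: continuous_measurable_fun.
rewrite (@continuous_FTC2 _ _ (fun z => - mono k a c (T z)))//.
- rewrite -EFinB opprK {2}/T expr0n addr0 /T e2 sqrtr1.
  rewrite {1}/mono subrr pos_powE// powR0 ?gt_eqF ?(lt_le_trans ltr01 k1)// mul0r oppr0 add0r.
  by rewrite /cut_mono p1.
- apply: continuous_in_subspaceT => z _.
  apply: cvgM; first by apply: cvgM; [exact: cvg_cst|exact: cvg_id].
  by apply: (@continuous_comp _ _ _ T (dmono k a c)); [exact: cT|exact: continuous_dmono].
- have cF : continuous (fun z => - mono k a c (T z)).
    move=> z; apply: cvgN; apply: (@continuous_comp _ _ _ T (mono k a c)).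
      exact: cT.
    exact: continuous_mono.
  split.
  + by move=> z ze; apply: ex_derive; exact: dF.
  + by apply: cvg_at_right_filter; exact: cF.
  + by apply: cvg_at_left_filter; exact: cF.
- by move=> z ze; rewrite derive1E; have [_ ->] := dF z ze.
Qed.

(** Each derivative lowers the exponent of [1 - t] by at most one and has nonnegative coefficients,
    so [n <= k] permits [n] of them while staying among profiles. *)
Lemma is_marginal_cut_mono n k a c : n%:R <= k -> 0 <= a -> 0 <= c -> is_marginal n (cut_mono k a c).
Proof.
elim: n k a c => [|n IH] k a c nk a0 c0.
  exists (cut_mono k a c); split; first exact: profile_cut_mono.
  by move=> p p0 /=; rewrite expr0 mul1r.
have k1 : 1 <= k by rewrite (le_trans _ nk)// -natr1 lerDr.
have k0 : 0 <= k := le_trans ler01 k1.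
have nk1 : n%:R <= k - 1 by rewrite lerBrDr natr1.
have nk' : n%:R <= k by rewrite (le_trans nk1)// gerBl.
apply: (@is_marginalS _ _ (cut_dmono k a c)).
- by apply: measurable_funD; [|apply: measurable_funD]; do 2 (apply: measurable_funM => //); exact: measurable_cut_mono.
- by move=> q; rewrite !addr_ge0 ?mulr_ge0 ?cut_mono_ge0.
- by move=> p p0; exact: integral_cut_dmono.
- by apply: is_marginalD; [|apply: is_marginalD]; (apply: is_marginalZ => //; apply: is_marginalZ; [rewrite ?mulr_ge0//|apply: IH => //; rewrite addr_ge0]).
Qed.

End monomial.

(** * Even dimensions *)
Section constants.
Context {R : realType}.
Local Notation mu := (@lebesgue_measure R).
Implicit Types (x t u : R).

Lemma integral_gt0 (f : R -> R) (a b e : R) : a < b -> 0 < e ->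
  measurable_fun setT f -> (forall x, 0 <= f x) ->
  (forall x, a < x < b -> e <= f x) ->
  (0 < \int[mu]_x (f x)%:E)%E.
Proof.
move=> ab e0 mf f0 fe.
apply: (@lt_le_trans _ _ (\int[mu]_x (e * \1_(`]a, b[%classic : set R) x)%:E)%E).
  under eq_integral do rewrite EFinM.
  rewrite ge0_integralZl_EFin ?(ltW e0)//; last first.
    exact/measurable_EFinP/measurable_indic.
  rewrite integral_indic//= setIT lebesgue_measure_itv/= lte_fin ab.
  by rewrite -EFinD -EFinM lte_fin mulr_gt0// subr_gt0.
apply: ge0_le_integral => //.
- by move=> x _; rewrite lee_fin mulr_ge0// ltW.
- by apply/measurable_EFinP; apply: measurable_funM => //; exact: measurable_indic.
- exact/measurable_EFinP.
- move=> x _; rewrite lee_fin indicE mem_setE in_itv/=.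
  by case: (boolP (a < x < b)) => [/fe|_]; rewrite ?mulr1 ?mulr0.
Qed.

(** The integrable majorant for both [unit_pow] and, after a reflection, [arcsine]. *)
Definition inv_sqrt u : R := if (0 < u) && (u <= 1) then u `^ (- 2^-1) else 0.

Lemma inv_sqrt_ge0 u : 0 <= inv_sqrt u.
Proof. by rewrite /inv_sqrt; case: ifP => // _; exact: powR_ge0. Qed.

Lemma measurable_inv_sqrt : measurable_fun setT inv_sqrt.
Proof.
apply: measurable_fun_ifT; [|exact: measurable_powR|exact: measurable_cst].
by apply: measurable_and; [exact: measurable_fun_ltr|exact: measurable_fun_ler].
Qed.

(* Integrate [inv_sqrt u = \int 1[0 <= w < u^(-1/2)] dw] in [u] first. *)
Lemma inv_sqrt_lty : (\int[mu]_u (inv_sqrt u)%:E < +oo)%E.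
Proof.
pose D (u w : R) : R := if [&& 0 < u, u <= 1, 0 <= w & w ^+ 2 * u < 1] then 1 else 0.
have mD : measurable_fun setT (fun z : R * R => (D z.1 z.2)%:E).
  apply/measurable_EFinP; apply: measurable_fun_ifT => //.
  apply: measurable_and; first by apply: measurable_fun_ltr; meas.
  apply: measurable_and; first by apply: measurable_fun_ler; meas.
  apply: measurable_and; first by apply: measurable_fun_ler; meas.
  by apply: measurable_fun_ltr; meas.
have D0 u w : (0 <= (D u w)%:E)%E by rewrite lee_fin /D; case: ifP.
have -> : (\int[mu]_u (inv_sqrt u)%:E = \int[mu]_u \int[mu]_w (D u w)%:E)%E.
  apply: eq_integral => u _; rewrite /inv_sqrt /D.
  have [/andP[u0 u1]|] := ifPn; last first.
    by move=> u01; rewrite integral0_eq// => w _; rewrite andbA (negbTE u01).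
  transitivity (\int[mu]_w (\1_(`[0%R, u `^ (- 2^-1)[%classic : set R) w)%:E)%E.
    rewrite integral_indic//= setIT lebesgue_measure_itv/= lte_fin powR_gt0//.
    by rewrite sube0.
  apply: eq_integral => w _; rewrite u0 u1/= indicE mem_setE in_itv/=.
  have [w0|//] := leP 0 w; congr (_%:E) => /=.
  have -> : (w ^+ 2 * u < 1) = (w < u `^ (- 2^-1)); last by case: ifP.
  have v0 : 0 < u `^ (- 2^-1) by rewrite powR_gt0.
  have v2 : (u `^ (- 2^-1)) ^+ 2 = u^-1.
    rewrite -powR_mulrn ?powR_ge0// -powRrM.
    have -> : - 2^-1 * 2%:R = -1 :> R by field.
    by rewrite powR_inv1 ?ltW.
  rewrite -[RHS](@ltr_pXn2r _ 2)// ?nnegrE ?(ltW v0)//.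
  by rewrite v2 -ltr_pdivlMr// mul1r.
rewrite tonelli_line//.
apply: (@le_lt_trans _ _ (\int[mu]_w (2%:E * ((1 + w ^+ 2)^-1)%:E))%E).
  have mw : measurable_fun setT (fun w : R => (1 + w ^+ 2)^-1).
    by apply: continuous_measurable_fun; exact: continuous_oneDsqrV.
  apply: ge0_le_integral => //.
  - by move=> w _; apply: integral_ge0.
  - apply: (measurable_integral_param (f := fun w u => (D u w)%:E)) => //.
    by apply: (measurable_fun2 (G := fun u w => (D u w)%:E)); meas.
  - by apply/measurable_EFinP; apply: measurable_funM.
  move=> w _.
  have w1 : 0 < 1 + w ^+ 2 by rewrite ltr_pwDl// sqr_ge0.
  (* Adding [u <= 1] and [w ^ 2 * u < 1] gives [u * (1 + w ^ 2) <= 2]. *)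
  apply: (@le_trans _ _ (\int[mu]_u (\1_(`[0%R, 2 / (1 + w ^+ 2)]%classic : set R) u)%:E)%E).
    apply: ge0_le_integral => //.
    + by apply: (measurable_fun2 (G := fun u w => (D u w)%:E)); meas.
    + exact/measurable_EFinP/measurable_indic.
    move=> u _; rewrite lee_fin /D indicE mem_setE in_itv/=.
    case: ifPn => // /and4P[u0 u1 w0 wu]; rewrite (ltW u0)//= ler_pdivlMr//.
    suff -> : u * (1 + w ^+ 2) <= 2 by [].
    by rewrite (_ : u * _ = u + w ^+ 2 * u); [lra|ring].
  rewrite integral_indic//= setIT lebesgue_measure_itv/= lte_fin divr_gt0//.
  by rewrite sube0.
rewrite ge0_integralZl_EFin//.
- by rewrite integral_oneDsqr -EFinM ltry.
- by move=> w _; rewrite lee_fin invr_ge0 addr_ge0// sqr_ge0.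
- by apply/measurable_EFinP; apply: continuous_measurable_fun; exact: continuous_oneDsqrV.
Qed.

Definition unit_pow k u : R := if (0 < u) && (u < 1) then u `^ k else 0.

Lemma unit_pow_ge0 k u : 0 <= unit_pow k u.
Proof. by rewrite /unit_pow; case: ifP => // _; exact: powR_ge0. Qed.

Lemma measurable_unit_pow k : measurable_fun setT (unit_pow k).
Proof.
apply: measurable_fun_ifT; [|exact: measurable_powR|exact: measurable_cst].
by apply: measurable_and; exact: measurable_fun_ltr.
Qed.

Lemma unit_pow_int k : - 2^-1 <= k ->
  (0 < \int[mu]_u (unit_pow k u)%:E < +oo)%E.
Proof.
move=> k0; apply/andP; split.
  (* As [k] may be negative, the bound passes through the positive exponent [k + 1], for which the
     power is increasing. *)
  apply: (@integral_gt0 _ 2^-1 1 (2^-1 `^ (k + 1))).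
  - lra.
  - by rewrite powR_gt0// invr_gt0.
  - exact: measurable_unit_pow.
  - exact: unit_pow_ge0.
  move=> u /andP[u0 u1]; rewrite /unit_pow u1 andbT (lt_trans _ u0); last lra.
  apply: (@le_trans _ _ (u `^ (k + 1))).
    by apply: ge0_ler_powR; rewrite ?nnegrE; lra.
  by apply: ger_powR; [apply/andP; split|]; lra.
apply: (le_lt_trans _ inv_sqrt_lty); apply: ge0_le_integral => //.
- by move=> u _; rewrite lee_fin unit_pow_ge0.
- apply/measurable_EFinP; exact: measurable_unit_pow.
- apply/measurable_EFinP; exact: measurable_inv_sqrt.
- move=> u _; rewrite lee_fin /unit_pow; case: ifPn => [/andP[u0 u1]|_]; last exact: inv_sqrt_ge0.
  by rewrite /inv_sqrt u0 (ltW u1)/=; apply: ger_powR => //; rewrite u0 ltW.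
Qed.

(** For [e > 0], up to the factor [pi], the density of the arcsine law on the interval from
    [- sqrt e] to [sqrt e]. *)
Definition arcsine e u : R := if u ^+ 2 < e then (e - u ^+ 2) `^ (- 2^-1) else 0.

Lemma arcsine_ge0 e u : 0 <= arcsine e u.
Proof. by rewrite /arcsine; case: ifP => // _; exact: powR_ge0. Qed.

Lemma measurable_arcsine : measurable_fun setT (fun z : R * R => arcsine z.1 z.2).
Proof.
apply: measurable_fun_ifT; last exact: measurable_cst.
  by apply: measurable_fun_ltr; meas.
by apply: (measurableT_comp (measurable_powR _)); meas.
Qed.

Lemma measurable_arcsine1 e : measurable_fun setT (arcsine e).
Proof. exact: (measurableT_comp measurable_arcsine (pair1_measurable e)). Qed.

(** The function is at least 1 on [(0, 1)], and [1 - u ^ 2 >= 1 - u] there bounds it by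
    [inv_sqrt (1 - u)]. *)
Lemma arcsine_int : (0 < \int[mu]_u (arcsine 1 u)%:E < +oo)%E.
Proof.
apply/andP; split.
  apply: (@integral_gt0 _ 0 1 1) => //.
  - exact: measurable_arcsine1.
  - exact: arcsine_ge0.
  move=> u /andP[u0 u1]; have u2 : u ^+ 2 < 1 by rewrite expr_lt1// ltW.
  have u3 : 0 < 1 - u ^+ 2 by lra.
  rewrite /arcsine u2 powRN invf_ge1 ?powR_gt0//.
  have u4 := sqr_ge0 u.
  rewrite -[leRHS](_ : 1 `^ 2^-1 = 1 :> R); last by rewrite powR1.
  by apply: ge0_ler_powR; rewrite ?nnegrE; lra.
rewrite integral_even//; last 3 first.
- apply/measurable_EFinP; exact: measurable_arcsine1.
- by move=> x; rewrite lee_fin arcsine_ge0.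
- by move=> x; rewrite /arcsine sqrrN.
apply: lte_mul_pinfty => //.
have H : (\int[mu]_u (inv_sqrt (- u + 1))%:E = \int[mu]_u (inv_sqrt u)%:E)%E.
  rewrite -[RHS](@integral_translate _ _ 1)%R; last 2 first.
  - apply/measurable_EFinP; exact: measurable_inv_sqrt.
  - by move=> x; rewrite lee_fin inv_sqrt_ge0.
  apply: (@integral_oppr _ (fun u => (inv_sqrt (u + 1))%:E)).
  - apply/measurable_EFinP; apply: (measurableT_comp measurable_inv_sqrt); meas.
  - by move=> x; rewrite lee_fin inv_sqrt_ge0.
apply: (le_lt_trans _ inv_sqrt_lty); rewrite -H [leLHS]integral_mkcond.
apply: ge0_le_integral => //.
- by move=> u _; rewrite patchE; case: ifP => // _; rewrite lee_fin arcsine_ge0.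
- apply/(measurable_restrictT _ _).1 => //.
  by apply: measurable_funTS; apply/measurable_EFinP; exact: measurable_arcsine1.
- apply/measurable_EFinP; apply: (measurableT_comp measurable_inv_sqrt); meas.
move=> u _; rewrite patchE mem_setE in_itv/= andbT.
case: ifPn => [u0|_]; last by rewrite lee_fin inv_sqrt_ge0.
rewrite lee_fin /arcsine; case: ifPn => [u1|_]; last exact: inv_sqrt_ge0.
have u1' : u < 1 by rewrite -(@expr_lt1 _ 2).
have -> : inv_sqrt (- u + 1) = (- u + 1) `^ (- 2^-1).
  rewrite /inv_sqrt ifT//; apply/andP; split; lra.
apply: powRN_homo; [lra|lra|].
by rewrite addrC lerB// expr2 ler_piMl// ltW.
Qed.

(** Scaling by [sqrt e]. That the mass does not depend on [e] is what makes the marginal in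
    [integral_unit_pow_arcsine] explicit. *)
Lemma integral_arcsine e : 0 < e ->
  (\int[mu]_u (arcsine e u)%:E = \int[mu]_u (arcsine 1 u)%:E)%E.
Proof.
move=> e0; have s0 : 0 < Num.sqrt e by rewrite sqrtr_gt0.
rewrite -[LHS](integral_scale s0); last 2 first.
- apply/measurable_EFinP; exact: measurable_arcsine1.
- by move=> x; rewrite lee_fin arcsine_ge0.
rewrite -ge0_integralZl_EFin ?(ltW s0)//; last 2 first.
- by move=> x _; rewrite lee_fin arcsine_ge0.
- by apply/measurable_EFinP; apply: (measurableT_comp (measurable_arcsine1 e)); meas.
apply: eq_integral => u _; rewrite -EFinM; congr EFin.
rewrite /arcsine exprMn sqr_sqrtr ?(ltW e0)// -[X in _ < X]mulr1 ltr_pM2l//.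
case: ifPn => u1; last by rewrite mulr0.
rewrite -[X in X - _](mulr1 e) -mulrBr powRM ?(ltW e0)//; last by rewrite subr_ge0 ltW.
by rewrite mulrA powRN powR12_sqrt ?ltW// mulfV ?gt_eqF// mul1r.
Qed.

End constants.

(** * Caps as mixtures of marginals *)

Section mixture.
Context {R : realType}.
Local Notation mu := (@lebesgue_measure R).
Implicit Types (x t u k q y h v : R).

Definition cap k q : R := if q < 1 then pos_pow k (1 - Num.sqrt q) else 0.

Lemma capE k : cap k = cut_mono 1 0 k 0 0.
Proof.
by apply/funext => q; rewrite /cap /cut_mono /mono oppr0 !powRr0 !mulr1.
Qed.

Lemma profile_cap k : 0 <= k -> profile (cap k).
Proof. by move=> k0; rewrite capE; apply: profile_cut_mono. Qed.

(* As functions of the distance [t], [(1 - t)^(k + 1/2)] is proportional to the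
   marginal of [\int_t^1 (1 - h)^(k - 1/2) / sqrt (h^2 - t^2) dh]; substituting
   [h = t + (1 - t) v] makes the latter a mixture over [v] of the [slice k v]. *)
Definition weight k v : R :=
  if (0 < v) && (v < 1) then v `^ (- 2^-1) * (1 - v) `^ (k - 2^-1) else 0.

Lemma weight_ge0 k v : 0 <= weight k v.
Proof. by rewrite /weight; case: ifP => // _; rewrite mulr_ge0 ?powR_ge0. Qed.

Lemma measurable_weight k : measurable_fun setT (weight k).
Proof.
apply: measurable_fun_ifT; last exact: measurable_cst.
  by apply: measurable_and; exact: measurable_fun_ltr.
apply: measurable_funM; first exact: measurable_powR.
by apply: (measurableT_comp (measurable_powR _)); meas.
Qed.

(** The last factor comes from [h ^ 2 - t ^ 2 = (1 - t) v (v + (2 - v) t)]; the powers of [1 - t],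
    Jacobian included, combine to the exponent [k]. *)
Definition slice k v q : R := cut_mono v (2 - v) k 0 2^-1 q.

Lemma measurable_slice k : measurable_fun setT (fun z : R * R => slice k z.1 z.2).
Proof.
have ms : measurable_fun setT (fun z : R * R => Num.sqrt z.2).
  have mq : measurable_fun setT (@Num.sqrt R).
    by apply: continuous_measurable_fun; exact: sqrt_continuous.
  exact: (measurableT_comp mq measurable_snd).
apply: measurable_fun_ifT; last exact: measurable_cst.
  by apply: measurable_fun_ltr; meas.
apply: measurable_funM.
  by apply: (measurableT_comp (measurable_pos_pow k)); meas.
apply: measurable_funM.
  exact: (measurableT_comp (measurable_powR _) ms).
by apply: (measurableT_comp (measurable_powR _)); meas.
Qed.

Lemma slice_ge0 k v q : 0 <= slice k v q.
Proof. exact: cut_mono_ge0. Qed.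

(** Links the integrands of [integral_unit_pow_arcsine] and of [integral_weight_slice] at
    [q + y ^ 2]. The two range conditions agree for [h > 0]; for [h <= 0] both sides vanish. *)
Lemma unit_pow_comp_arcsine k q y h : 0 < q ->
  unit_pow (k - 2^-1) (1 - h) * arcsine (h ^+ 2 - q) y =
  if (Num.sqrt (q + y ^+ 2) < h) && (h < 1) then
    (1 - h) `^ (k - 2^-1) * (h ^+ 2 - (q + y ^+ 2)) `^ (- 2^-1) else 0.
Proof.
move=> q0; have y2 := sqr_ge0 y.
have q1 : 0 < q + y ^+ 2 by lra.
rewrite /unit_pow /arcsine.
have [h0|h0] := leP h 0.
  have h1 : (1 - h < 1) = false by apply/negbTE; rewrite -leNgt; lra.
  rewrite h1 andbF mul0r.
  by rewrite ltNge (le_trans h0) ?sqrtr_ge0.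
have h1 : 1 - h < 1 by lra.
rewrite h1 andbT subr_gt0 andbC.
have -> : (Num.sqrt (q + y ^+ 2) < h) = (y ^+ 2 < h ^+ 2 - q).
  rewrite -(@ltr_pXn2r _ 2)// ?nnegrE ?sqrtr_ge0 ?(ltW h0)// sqr_sqrtr ?(ltW q1)//.
  by rewrite ltrBrDl.
case: (h < 1); rewrite /= ?mul0r//; case: ifP; rewrite ?mulr0// => _.
by rewrite opprD addrA.
Qed.

(* The substitution [h = t + (1 - t) v]. *)
Lemma integral_weight_slice k q : 0 <= k -> 0 < q ->
  (\int[mu]_v (weight k v * slice k v q)%:E =
   \int[mu]_h (if (Num.sqrt q < h) && (h < 1) then
    (1 - h) `^ (k - 2^-1) * (h ^+ 2 - q) `^ (- 2^-1) else 0)%:E)%E.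
Proof.
move=> k0 q0.
pose t := Num.sqrt q.
have t0 : 0 < t by rewrite sqrtr_gt0.
have t2 : t ^+ 2 = q by rewrite sqr_sqrtr// ltW.
rewrite /slice /cut_mono -/t; have [q1|q1] := leP 1 q.
  have t1 : 1 <= t by rewrite -sqrtr1 ler_wsqrtr.
  rewrite integral0_eq; last by move=> v _; rewrite mulr0.
  rewrite integral0_eq// => h _; rewrite ifF//; apply/negbTE/negP => /andP[]; lra.
have t1 : 0 < 1 - t by rewrite subr_gt0 -(@expr_lt1 _ 2)// ?ltW// t2.
pose P h : R := if (t < h) && (h < 1) then
    (1 - h) `^ (k - 2^-1) * (h ^+ 2 - q) `^ (- 2^-1) else 0.
have mP : measurable_fun setT P.
  apply: measurable_fun_ifT; last exact: measurable_cst.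
    by apply: measurable_and; exact: measurable_fun_ltr.
  by apply: measurable_funM; apply: (measurableT_comp (measurable_powR _)); meas.
have P0 h : 0 <= P h by rewrite /P; case: ifP => // _; rewrite mulr_ge0 ?powR_ge0.
rewrite -/P -[RHS](@integral_translate _ (EFin \o P) t); last 2 first.
- exact/measurable_EFinP.
- by move=> h; rewrite lee_fin.
rewrite -(integral_scale t1 (f := fun h => (P (h + t))%:E)); last 2 first.
- by apply/measurable_EFinP; apply: (measurableT_comp mP); meas.
- by move=> h; rewrite lee_fin.
rewrite -ge0_integralZl_EFin ?(ltW t1)//; last 2 first.
- by move=> h _; rewrite lee_fin.
- by apply/measurable_EFinP; apply: (measurableT_comp mP); meas.
apply: eq_integral => v _; rewrite -EFinM; congr EFin.
rewrite /weight /P.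
have -> : (t < (1 - t) * v + t) = (0 < v) by rewrite -subr_gt0 addrK pmulr_rgt0.
have -> : ((1 - t) * v + t < 1) = (v < 1).
  by rewrite -ltrBrDr gtr_pMr.
case: ifPn => [/andP[v0 v1]|_]; last by rewrite mul0r mulr0.
have v1' : 0 < 1 - v by rewrite subr_gt0.
have w0 : 0 < v + (2 - v) * t by rewrite addr_gt0// mulr_gt0//; lra.
rewrite /mono (pos_powE _ (ltW t1)) oppr0 powRr0 mul1r.
have -> : 1 - ((1 - t) * v + t) = (1 - t) * (1 - v) by ring.
have -> : ((1 - t) * v + t) ^+ 2 - q = (1 - t) * (v * (v + (2 - v) * t)) by rewrite -t2; ring.
have tn0 : (1 - t) != 0 by rewrite gt_eqF.
rewrite !powRM ?mulr_ge0 ?ltW//.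
have -> : (1 - t) `^ k = (1 - t) * (1 - t) `^ (k - 2^-1) * (1 - t) `^ (- 2^-1).
  rewrite -{2}[1 - t]powRr1 ?ltW// -!powRD ?tn0 ?implybT//.
  by congr (_ `^ _); lra.
ring.
Qed.

Definition arcsine_mass : R := fine (\int[mu]_u (arcsine 1 u)%:E)%E.
Definition unit_pow_mass k : R := fine (\int[mu]_u (unit_pow (k - 2^-1) u)%:E)%E.

Lemma arcsine_mass_gt0 : 0 < arcsine_mass.
Proof. by apply: fine_gt0; exact: arcsine_int. Qed.

Lemma unit_pow_mass_gt0 k : 0 <= k -> 0 < unit_pow_mass k.
Proof. by move=> k0; apply: fine_gt0; apply: unit_pow_int; lra. Qed.

(** Integrating over [y] first gives [arcsine_mass] for each [h > sqrt q]. What remains is the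
    integral of [(1 - h)^(k - 1/2)] from [sqrt q] to 1, which scales as [(1 - sqrt q)^(k + 1/2)]. *)
Lemma integral_unit_pow_arcsine k q : 0 <= k -> 0 < q ->
  (\int[mu]_y \int[mu]_h (unit_pow (k - 2^-1) (1 - h) * arcsine (h ^+ 2 - q) y)%:E =
   (arcsine_mass * unit_pow_mass k * cap (k + 2^-1) q)%:E)%E.
Proof.
move=> k0 q0.
have arcsine_massE : (\int[mu]_u (arcsine 1 u)%:E = arcsine_mass%:E)%E.
  by have /andP[h1 h2] := @arcsine_int R; rewrite /arcsine_mass fineK// ge0_fin_numE// ltW.
have unit_pow_massE : (\int[mu]_u (unit_pow (k - 2^-1) u)%:E = (unit_pow_mass k)%:E)%E.
  have /andP[h1 h2] : (0 < \int[mu]_u (unit_pow (k - 2^-1) u)%:E < +oo)%E by apply: unit_pow_int; lra.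
  by rewrite /unit_pow_mass fineK// ge0_fin_numE// ltW.
have mu1 : measurable_fun setT (fun h : R => unit_pow (k - 2^-1) (1 - h)).
  by apply: (measurableT_comp (measurable_unit_pow _)); meas.
have mua : measurable_fun setT (fun z : R * R =>
    (unit_pow (k - 2^-1) (1 - z.2) * arcsine (z.2 ^+ 2 - q) z.1)%:E).
  apply/measurable_EFinP; apply: measurable_funM.
    by apply: (measurableT_comp mu1); meas.
  have mg : measurable_fun setT (fun z : R * R => (z.2 ^+ 2 - q, z.1)).
    by apply: measurable_fun_pair; meas.
  exact: (measurableT_comp measurable_arcsine mg).
rewrite tonelli_line//; last first.
  by move=> y h; rewrite lee_fin mulr_ge0 ?unit_pow_ge0 ?arcsine_ge0.
pose g := Num.sqrt q.
have g0 : 0 < g by rewrite sqrtr_gt0.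
have g2 : g ^+ 2 = q by rewrite sqr_sqrtr// ltW.
pose U u := if u < 1 - g then unit_pow (k - 2^-1) u else 0.
have mU : measurable_fun setT U.
  apply: measurable_fun_ifT; [exact: measurable_fun_ltr|exact: measurable_unit_pow|exact: measurable_cst].
have U0 u : 0 <= U u by rewrite /U; case: ifP => // _; exact: unit_pow_ge0.
transitivity (\int[mu]_h (arcsine_mass%:E * (U (- h + 1))%:E))%E.
  apply: eq_integral => h _; under eq_integral do rewrite EFinM.
  rewrite ge0_integralZl_EFin ?unit_pow_ge0//; last 2 first.
  - by move=> y _; rewrite lee_fin arcsine_ge0.
  - by apply/measurable_EFinP; exact: measurable_arcsine1.
  rewrite /U [- h + 1]addrC; have [hg|hg] := ltP (1 - h) (1 - g).
    rewrite integral_arcsine; first by rewrite arcsine_massE muleC.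
    by rewrite subr_gt0 -g2 ltr_pXn2r// ?nnegrE; lra.
  rewrite mule0; have [h0|h0] := leP h 0.
    rewrite /unit_pow ifF ?mul0e//; apply/negbTE/negP => /andP[]; lra.
  rewrite integral0_eq ?mule0// => y _; rewrite /arcsine ifF//.
  apply/negbTE; rewrite -leNgt (le_trans _ (sqr_ge0 y))// subr_le0 -g2.
  by rewrite ler_pXn2r// ?nnegrE; lra.
rewrite ge0_integralZl_EFin ?(ltW arcsine_mass_gt0)//; last 2 first.
- by move=> h _; rewrite lee_fin.
- by apply/measurable_EFinP; apply: (measurableT_comp mU); meas.
rewrite -mulrA EFinM; congr (_ * _)%E.
rewrite (@integral_oppr _ (fun h => (U (h + 1))%:E)); last 2 first.
- by apply/measurable_EFinP; apply: (measurableT_comp mU); meas.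
- by move=> h; rewrite lee_fin.
rewrite (@integral_translate _ (EFin \o U)); last 2 first.
- exact/measurable_EFinP.
- by move=> h; rewrite lee_fin.
rewrite /cap -/g; have [q1|q1] := ltP q 1; last first.
  have g1 : 1 <= g by rewrite -sqrtr1 ler_wsqrtr.
  rewrite mulr0 integral0_eq// => u _ /=; rewrite /U /unit_pow.
  case: ifPn => // ug; rewrite ifF//; apply/negbTE/negP => /andP[]; lra.
have g1 : 0 < 1 - g by rewrite subr_gt0 -(@expr_lt1 _ 2)// ?ltW// g2.
rewrite -(integral_scale g1); last 2 first.
- exact/measurable_EFinP.
- by move=> h; rewrite lee_fin.
rewrite -ge0_integralZl_EFin ?(ltW g1)//; last 2 first.
- by move=> h _; rewrite lee_fin.
- by apply/measurable_EFinP; apply: (measurableT_comp mU); meas.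
rewrite mulrC EFinM -unit_pow_massE pos_powE ?(ltW g1)// -ge0_integralZl_EFin ?powR_ge0//; last 2 first.
- by move=> h _; rewrite lee_fin unit_pow_ge0.
- by apply/measurable_EFinP; exact: measurable_unit_pow.
apply: eq_integral => u _; rewrite /= -!EFinM; congr EFin.
rewrite /U gtr_pMr// /unit_pow pmulr_rgt0//.
case: (ltP u 1) => u1; rewrite ?andbT ?andbF ?mulr0//.
have [u0|u0] := ltP 0 u; last by rewrite /= !mulr0.
have gu1 : (1 - g) * u < 1.
  apply: (@lt_trans _ _ (1 - g)); last lra.
  by rewrite gtr_pMr.
rewrite gu1 /=.
rewrite powRM ?ltW// mulrA; congr (_ * _).
have gn0 : (1 - g) != 0 by rewrite gt_eqF.
rewrite -{1}[1 - g]powRr1 ?ltW// -powRD ?gn0 ?implybT//.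
by congr (_ `^ _); lra.
Qed.

End mixture.

(** * Overlaps of caps in all positive dimensions *)

Section lens_cap.
Context {R : realType}.
Local Notation mu := (@lebesgue_measure R).
Implicit Types (f g : R -> \bar R) (h : R -> R) (p q r : R).

Lemma eq_iter_marginal f g n : (forall x, 0 < x -> f x = g x) ->
  forall x, 0 < x -> iter n marginal f x = iter n marginal g x.
Proof.
move=> fg; elim: n => //= n IH x x0.
by apply: eq_integral => z _; rewrite IH// ltr_wpDr// sqr_ge0.
Qed.

Lemma eq_lens f g p q r : (forall x, 0 < x -> f x = g x) -> 0 < p ->
  lens f p q r = lens g p q r.
Proof.
move=> fg p0; apply: eq_integral => z _; apply: fg.
by rewrite lt_max ltr_wpDr// sqr_ge0.
Qed.

Lemma lensZ f (k : R) p q r : 0 <= k -> measurable_fun setT f -> (forall x, 0 <= f x)%E ->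
  (lens (fun x => k%:E * f x) p q r = k%:E * lens f p q r)%E.
Proof.
move=> k0 mf f0; rewrite /lens ge0_integralZl_EFin//.
by apply: (measurableT_comp mf); meas.
Qed.

(** Up to [pi ^ k], the kernel is the ball kernel of [W]: [k.*2] marginals lead from [W] to [h],
    then come [n] more, and the overlap integral itself accounts for the last dimension. *)
Lemma psd_lens_marginal k n h (I : finType) (x : I -> nat -> R) p :
  tame (EFin \o h) -> is_marginal k h -> 0 < p ->
  psd (fun i j => fine (lens (iter n marginal (EFin \o h)) p p (dist (n + k.*2).+1 (x i) (x j)))).
Proof.
move=> th [W [pW Wh]] p0.
have pk : 0 < pi ^+ k :> R by rewrite exprn_gt0// pi_gt0.
have [mf f0 _ _] := tame_iter_marginal n th.
have := psdZ (_ : 0 <= (pi ^+ k)^-1) (@psd_ball_kernel _ W (n + k.*2).+1 I x (fun=> p) pW (fun=> p0)).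
rewrite invr_ge0 ltW// => /(_ isT); apply: eq_psd => i j /=.
rewrite (@eq_lens _ (fun x => (pi ^+ k)%:E * iter n marginal (EFin \o h) x)%E)//; last first.
  move=> y y0; rewrite iterD.
  rewrite -[RHS]/((fun x => (pi ^+ k)%:E * iter n marginal (EFin \o h) x)%E y).
  rewrite -iter_marginalZ ?(ltW pk)//.
  by apply: eq_iter_marginal => // z z0; rewrite Wh// EFinM.
rewrite lensZ ?(ltW pk)// fineM//; last first.
  by rewrite ge0_fin_numE ?lens_ge0// lens_lty//; exact: tame_iter_marginal.
by rewrite mulrA mulVf ?gt_eqF// mul1r.
Qed.

Lemma psd_lens_cap_odd k nu (I : finType) (x : I -> nat -> R) p :
  k%:R <= nu -> 0 < p ->
  psd (fun i j => fine (lens (EFin \o cap nu) p p (dist k.*2.+1 (x i) (x j)))).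
Proof.
move=> knu p0; have nu0 : 0 <= nu := le_trans (ler0n _ _) knu.
apply: (@psd_lens_marginal k 0 (cap nu)) => //; first exact/tame_profile/profile_cap.
by rewrite capE; apply: is_marginal_cut_mono.
Qed.

(** The cap is, up to a constant, the mixture over [v] of marginals of [slice nu v]. Each slice is
    covered by [psd_lens_marginal] with [n = 1], and [psd_integral] performs the mixture. *)
Lemma psd_lens_cap_even k nu (I : finType) (x : I -> nat -> R) p :
  k%:R <= nu -> 0 < p ->
  psd (fun i j => fine (lens (EFin \o cap (nu + 2^-1)) p p (dist k.*2.+2 (x i) (x j)))).
Proof.
move=> knu p0; have nu0 : 0 <= nu := le_trans (ler0n _ _) knu.
pose r i j := dist k.*2.+2 (x i) (x j).
pose m i j z := Num.max (p + (z - r i j) ^+ 2) (p + z ^+ 2).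
have m0 i j z : 0 < m i j z by rewrite lt_max ltr_wpDr// sqr_ge0.
have mm i j : measurable_fun setT (m i j) by rewrite /m; meas.
pose g i j v z y := (weight nu v * slice nu v (m i j z + y ^+ 2))%:E.
have g0 i j v z y : (0 <= g i j v z y)%E by rewrite lee_fin mulr_ge0 ?weight_ge0 ?slice_ge0.
have mg d (T : measurableType d) i j (a b c : T -> R) :
    measurable_fun setT a -> measurable_fun setT b -> measurable_fun setT c ->
    measurable_fun setT (fun t => g i j (a t) (b t) (c t)).
  move=> ma mb mc; apply/measurable_EFinP; apply: measurable_funM.
    exact: (measurableT_comp (@measurable_weight R nu) ma).
  have mp : measurable_fun setT (fun t => (a t, m i j (b t) + c t ^+ 2)).
    apply: measurable_fun_pair => //; apply: measurable_funD; last exact: measurable_funX.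
    exact: (measurableT_comp (mm i j) mb).
  exact: (measurableT_comp (@measurable_slice R nu) mp).
pose k0 v i j := weight nu v * fine (lens (marginal (EFin \o slice nu v)) p p (r i j)).
have tames v : 0 < v < 1 -> tame (EFin \o slice nu v).
  move=> /andP[v0 v1]; apply/tame_profile/profile_cut_mono => //; lra.
have k0E v i j : ((k0 v i j)%:E = \int[mu]_z \int[mu]_y g i j v z y)%E.
  rewrite /k0 /g; have [v01|v01] := boolP (0 < v < 1); last first.
    rewrite integral0_eq => [|z _]; first by rewrite /weight (negbTE v01) mul0r.
    by rewrite integral0_eq// => y _; rewrite /weight (negbTE v01) mul0r.
  have ts := tames v v01; have tq := tame_marginal ts.
  have [ms s0 _ _] := ts; have [mq sq _ _] := tq.
  rewrite EFinM fineK; last by rewrite ge0_fin_numE ?lens_ge0// lens_lty.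
  rewrite -lensZ ?weight_ge0// -marginalZ ?weight_ge0//.
(* Moving the integral over [v] innermost turns it into one over [h]; the integral over [y] then
   produces the cap. *)
have cE i j : (\int[mu]_v (k0 v i j)%:E =
    (arcsine_mass * unit_pow_mass nu)%:E * lens (EFin \o cap (nu + 2^-1)) p p (r i j))%E.
  have [mc c0 _ _] := tame_profile (@profile_cap R (nu + 2^-1) ltac:(lra)).
  have cc : 0 <= arcsine_mass * unit_pow_mass nu :> R by rewrite mulr_ge0 ?ltW ?arcsine_mass_gt0 ?unit_pow_mass_gt0.
  under eq_integral do rewrite k0E.
  rewrite -lensZ// tonelli_line; last 2 first.
  - apply: (measurable_integral_param (f := fun (t : R * R) y => g i j t.1 t.2 y)) => //.
    by apply: mg; meas.
  - by move=> v z; apply: integral_ge0.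
  apply: eq_integral => z _; rewrite tonelli_line//; last by apply: mg; meas.
  rewrite -EFinM -integral_unit_pow_arcsine//; last exact: m0.
  apply: eq_integral => y _; have y2 := sqr_ge0 y; have mz := m0 i j z.
  rewrite integral_weight_slice//; last lra.
  by apply: eq_integral => h _; rewrite unit_pow_comp_arcsine.
have : psd (fun i j => fine (\int[mu]_v (k0 v i j)%:E)).
  apply: psd_integral.
  - move=> v; rewrite /k0; have [v01|v01] := boolP (0 < v < 1); last first.
      apply: (@eq_psd R _ (fun i j => 0 * 0)); last exact: psd_rank1.
      by move=> i j; rewrite /weight (negbTE v01) !mul0r.
    apply: psdZ; first exact: weight_ge0.
    apply: (@psd_lens_marginal k 1 (slice nu v)) => //; first exact: tames.
    by case/andP: v01 => v0 v1; apply: is_marginal_cut_mono => //; lra.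
  - move=> v i j; apply: mulr_ge0; first exact: weight_ge0.
    apply: fine_ge0; apply: lens_ge0 => y; apply: marginal_ge0 => z.
    by rewrite lee_fin slice_ge0.
  - move=> i j; apply/measurable_EFinP; rewrite (_ : _ \o _ = fun v => \int[mu]_z \int[mu]_y g i j v z y)%E.
      apply: (measurable_integral_param (f := fun v z => \int[mu]_y g i j v z y)%E).
        apply: (measurable_integral_param (f := fun (t : R * R) y => g i j t.1 t.2 y)) => //.
        by apply: mg; meas.
      by move=> v z; apply: integral_ge0.
    by apply/funext => v /=; rewrite k0E.
  - move=> i j; rewrite cE; apply: lte_mul_pinfty => //.
    + by rewrite lee_fin mulr_ge0 ?ltW ?arcsine_mass_gt0 ?unit_pow_mass_gt0.
    + by rewrite lens_lty//; apply/tame_profile/profile_cap; lra.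
move=> /(psdZ (_ : 0 <= (arcsine_mass * unit_pow_mass nu)^-1)).
have cc : 0 < arcsine_mass * unit_pow_mass nu :> R by rewrite mulr_gt0 ?arcsine_mass_gt0 ?unit_pow_mass_gt0.
rewrite invr_ge0 ltW// => /(_ isT); apply: eq_psd => i j /=.
rewrite cE fineM//; last first.
  rewrite ge0_fin_numE ?lens_lty//; first by apply/tame_profile/profile_cap; lra.
  by apply: lens_ge0; case: (tame_profile (@profile_cap R (nu + 2^-1) ltac:(lra))).
by rewrite mulrA mulVf ?gt_eqF// mul1r.
Qed.

(** The hypothesis reads [d / 2 <= nu]: for [d = 2 k] this is [k <= nu], and for [d = 2 k + 1] it is
    [k <= nu - 1/2]. *)
Lemma psd_lens_cap d nu (I : finType) (x : I -> nat -> R) p :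
  (d.+1%:R + 1) / 2 <= nu + 1 -> 0 < p ->
  psd (fun i j => fine (lens (EFin \o cap nu) p p (dist d.+1 (x i) (x j)))).
Proof.
have dE : d%:R = (odd d)%:R + 2 * (d./2)%:R :> R.
  by rewrite -{1}(odd_double_half d) natrD -mul2n natrM.
rewrite -natr1 {}dE => dnu p0.
have := odd_double_half d; move: (d./2) dnu => k; case: (odd d) => /= dnu <-; last first.
  by apply: psd_lens_cap_odd => //; rewrite mulr0n in dnu; lra.
have -> : nu = (nu - 2^-1) + 2^-1 by lra.
by apply: psd_lens_cap_even => //; rewrite mulr1n in dnu; lra.
Qed.

End lens_cap.

(** * The Askey functions *)
Section askey.
Context {R : realType}.
Local Notation mu := (@lebesgue_measure R).
Implicit Types (k p q r z u nu : R).

Lemma cap_ge0 k q : 0 <= cap k q.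
Proof. by rewrite capE cut_mono_ge0. Qed.

Lemma cap_le1 k q : 0 <= k -> cap k q <= 1.
Proof.
move=> k0; rewrite /cap; case: ifP => // _.
have sq := sqrtr_ge0 q.
apply: (@le_trans _ _ (pos_pow k 1)); first by apply: pos_pow_homo => //; lra.
by rewrite pos_powE// powR1.
Qed.

Lemma measurable_cap k : measurable_fun setT (cap k).
Proof. by rewrite capE; exact: measurable_cut_mono. Qed.

(** The approach is from the right, so the jump of [cap 0] at 1 does no harm. *)
Lemma cap_harmonic_cvg k q : 0 <= k -> cap k (harmonic n + q) @[n --> \oo] --> cap k q.
Proof.
move=> k0; have [q1|q1] := leP 1 q.
  apply: cvg_near_cst; apply: nearW => n.
  by rewrite /cap !ltNge q1 (le_trans q1)// lerDr harmonic_ge0.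
pose phi p := pos_pow k (1 - Num.sqrt (p + q)).
have cphi : continuous phi.
  have cq : continuous (fun p : R => p + q).
    by move=> p; apply: cvgD; [exact: cvg_id|exact: cvg_cst].
  move=> p; have cs := continuous_comp (cq p) (@sqrt_continuous R _).
  have cb : {for p, continuous (fun p : R => 1 - Num.sqrt (p + q))}.
    by apply: cvgB; [exact: cvg_cst|exact: cs].
  have cc : {for 1 - Num.sqrt (p + q), continuous (pos_pow k)} by exact: continuous_pos_pow.
  exact: (@continuous_comp _ _ _ (fun p : R => 1 - Num.sqrt (p + q)) (pos_pow k) p cb cc).
have c0 : phi (harmonic n) @[n --> \oo] --> phi 0.
  by apply: (@cvg_comp _ _ _ harmonic phi _ _ _ (@cvg_harmonic R)); exact: cphi.
have <- : phi 0 = cap k q by rewrite /phi add0r /cap q1.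
apply: cvg_trans c0; apply: near_eq_cvg; near=> n.
rewrite /phi /cap ifT// -ltrBrDr.
near: n; apply: (cvgr_lt (0 : R)); first exact: cvg_harmonic.
by rewrite subr_gt0.
Unshelve. all: by end_near. Qed.

(** Dominated convergence: caps are at most 1 and the integrand vanishes for [|z| > 1]. *)
Lemma lens_cap_cvg k r : 0 <= k ->
  (lens (EFin \o cap k) (harmonic n) (harmonic n) r @[n --> \oo]
   --> lens (EFin \o cap k) 0%R 0%R r)%E.
Proof.
move=> k0; pose g z : \bar R := (\1_(`[-1, 1]%classic : set R) z)%:E.
have mc := measurable_cap k.
apply: (@dominated_cvg _ _ _ mu setT measurableT _ _ g).
- by move=> n; apply/measurable_EFinP; apply: (measurableT_comp mc); meas.
- move=> z _; apply: cvg_EFin; first by apply: nearW.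
  rewrite !add0r.
  have := @cap_harmonic_cvg k (Num.max ((z - r) ^+ 2) (z ^+ 2)) k0.
  by under eq_fun do rewrite addrC addr_maxl ![_ + harmonic _]addrC.
- by [].
- apply/integrableP; split; first exact/measurable_EFinP/measurable_indic.
  under eq_integral do rewrite gee0_abs ?lee_fin//.
  by rewrite integral_indic//= setIT lebesgue_measure_itv/= lte_fin; case: ifP; rewrite ltry.
- move=> n z _; rewrite gee0_abs ?lee_fin ?cap_ge0// /g indicE mem_setE in_itv/= -ler_norml.
  case: (leP `|z| 1) => z1; first exact: cap_le1.
  rewrite /cap ifF// ltNge; apply/negbF; rewrite le_max; apply/orP; right.
  apply: (@le_trans _ _ (z ^+ 2)); last by rewrite lerDr harmonic_ge0.
  by rewrite -(real_normK (num_real z)) expr_ge1// ltW.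
Qed.

Definition tent k u : R := if `|u| < 1 then (1 - `|u|) `^ k else 0.

Lemma tent_ge0 k u : 0 <= tent k u.
Proof. by rewrite /tent; case: ifP => // _; exact: powR_ge0. Qed.

Lemma measurable_tent k : measurable_fun setT (tent k).
Proof.
have mn : measurable_fun setT (fun u : R => `|u|) by exact: normr_measurable.
apply: measurable_fun_ifT; last exact: measurable_cst.
  exact: measurable_fun_ltr.
by apply: (measurableT_comp (measurable_powR _)); meas.
Qed.

Lemma tent_int k : 0 <= k -> (0 < \int[mu]_u (tent k u)%:E < +oo)%E.
Proof.
move=> k0; apply/andP; split.
  apply: (@integral_gt0 _ _ 0 2^-1 (2^-1 `^ k)).
  - by lra.
  - by rewrite powR_gt0// invr_gt0.
  - exact: measurable_tent.
  - exact: tent_ge0.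
  - move=> u /andP[u0 u1]; rewrite /tent gtr0_norm// ifT; last lra.
    by apply: ge0_ler_powR; rewrite ?nnegrE; lra.
apply: (@le_lt_trans _ _ (2 * 1)%:E); last exact: ltry.
apply: integral_unit_bound.
- by apply/measurable_EFinP; exact: measurable_tent.
- by move=> u; rewrite lee_fin tent_ge0.
- move=> u; rewrite lee_fin /tent; case: ifPn => // u1.
  have u0 := normr_ge0 u.
  rewrite -[leRHS](_ : 1 `^ k = 1 :> R); last by rewrite powR1.
  by apply: ge0_ler_powR; rewrite ?nnegrE; lra.
- move=> u u1; rewrite /tent ifF//; apply/negbTE; rewrite -leNgt.
  by rewrite -(@expr_ge1 _ 2)// real_normK ?num_real.
Qed.

(** Centred at the midpoint, the larger squared distance is [(|z| + r / 2) ^ 2]. Scaling [z] by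
    [1 - r / 2] raises the exponent by one and leaves the constant integral of [tent]. *)
Lemma lens_cap00 k r : 0 <= k -> 0 <= r ->
  lens (EFin \o cap k) 0 0 r =
  (pos_pow (k + 1) (1 - r / 2) * fine (\int[mu]_u (tent k u)%:E))%:E.
Proof.
move=> k0 r0.
have tE : (\int[mu]_u (tent k u)%:E = (fine (\int[mu]_u (tent k u)%:E))%:E)%E.
  by have /andP[h1 h2] := tent_int k0; rewrite fineK// ge0_fin_numE// ltW.
have mc := measurable_cap k.
pose h z := cap k ((`|z| + r / 2) ^+ 2).
have mh : measurable_fun setT h.
  apply: (measurableT_comp mc); apply: measurable_funX; apply: measurable_funD => //.
have h0 z : 0 <= h z by exact: cap_ge0.
have r2 : 0 <= r / 2 by rewrite divr_ge0.
have hE z : h z = if `|z| + r / 2 < 1 then pos_pow k (1 - r / 2 - `|z|) else 0.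
  have z0 : 0 <= `|z| + r / 2 by rewrite addr_ge0.
  rewrite /h /cap sqrtr_sqr (ger0_norm z0) (@expr_lt1 _ 2)//; case: ifP => // _.
  by congr pos_pow; ring.
transitivity (\int[mu]_z (h z)%:E)%E.
  rewrite /lens -[LHS](@integral_translate _ _ (r / 2)); last 2 first.
  - by apply/measurable_EFinP; apply: (measurableT_comp mc); meas.
  - by move=> z; rewrite lee_fin cap_ge0.
  apply: eq_integral => z _ /=; congr ((cap k _)%:E); rewrite !add0r.
  have -> : z + r / 2 - r = z - r / 2 by field.
  have [z0|z0] := leP 0 z.
    rewrite max_r ?ger0_norm// -subr_ge0.
    suff -> : (z + r / 2) ^+ 2 - (z - r / 2) ^+ 2 = 4 * (z * (r / 2)) by rewrite mulr_ge0// mulr_ge0.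
    by ring.
  rewrite max_l ?ltr0_norm//; first by ring.
  rewrite -subr_ge0.
  suff -> : (z - r / 2) ^+ 2 - (z + r / 2) ^+ 2 = 4 * ((- z) * (r / 2)).
    by rewrite mulr_ge0// mulr_ge0// oppr_ge0 ltW.
  by ring.
have [r1|r1] := leP (1 - r / 2) 0.
  rewrite /pos_pow max_r// powR0 ?mul0r; last by rewrite gt_eqF; lra.
  rewrite integral0_eq// => z _; rewrite hE ifF//.
  by apply/negbTE; rewrite -leNgt; have := normr_ge0 z; lra.
rewrite EFinM -tE.
rewrite -(integral_scale r1); last 2 first.
- exact/measurable_EFinP.
- by move=> z; rewrite lee_fin.
rewrite -!ge0_integralZl_EFin ?pos_pow_ge0 ?(ltW r1)//; last 4 first.
- by move=> z _; rewrite lee_fin tent_ge0.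
- by apply/measurable_EFinP; exact: measurable_tent.
- by move=> z _; rewrite lee_fin.
- by apply/measurable_EFinP; apply: (measurableT_comp mh); meas.
apply: eq_integral => u _; rewrite -!EFinM; congr EFin.
rewrite hE normrM gtr0_norm// /tent.
have -> : ((1 - r / 2) * `|u| + r / 2 < 1) = (`|u| < 1).
  by rewrite -ltrBrDr gtr_pMr.
case: ifPn => u1; last by rewrite !mulr0.
rewrite !pos_powE ?(ltW r1)//; last first.
  by rewrite -[X in X - _]mulr1 -mulrBr mulr_ge0 ?ltW// subr_gt0.
have -> : 1 - r / 2 - (1 - r / 2) * `|u| = (1 - r / 2) * (1 - `|u|) by ring.
rewrite powRM ?(ltW r1)//; last by rewrite subr_ge0 ltW.
rewrite mulrA; congr (_ * _).
have rn0 : 1 - r / 2 != 0 by rewrite gt_eqF.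
rewrite -{1}[1 - r / 2]powRr1 ?(ltW r1)// -powRD ?rn0 ?implybT//.
by congr (_ `^ _); ring.
Qed.

Lemma dist_ge0 d (x y : nat -> R) : 0 <= dist d x y.
Proof. exact: sqrtr_ge0. Qed.

Lemma distZ d a (x y : nat -> R) : 0 <= a ->
  dist d (fun n => a * x n) (fun n => a * y n) = a * dist d x y.
Proof.
move=> a0; rewrite /dist.
under eq_bigr do rewrite -mulrBr exprMn.
by rewrite -mulr_sumr sqrtrM ?sqr_ge0// sqrtr_sqr ger0_norm.
Qed.

Theorem psd_askey d nu u (I : finType) (x : I -> nat -> R) :
  (d%:R + 1) / 2 <= nu -> 0 < u ->
  psd (fun i j => pos_pow nu (1 - dist d (x i) (x j) / u)).
Proof.
case: d => [|d] dnu u0.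
  (* In dimension 0 all distances vanish and the kernel is the constant 1. *)
  apply: (@eq_psd _ _ (fun i j => 1 * 1)); last exact: psd_rank1.
  by move=> i j; rewrite /dist big_ord0 sqrtr0 mul0r subr0 pos_powE// powR1 mulr1.
have k0 : 0 <= nu - 1.
  by move: dnu; rewrite -natr1; have := ler0n R d; lra.
(* The overlap depends on [1 - r / 2]; this scaling turns it into [1 - r / u]. *)
pose x' i n := 2 / u * x i n.
have : psd (fun i j => fine (lens (EFin \o cap (nu - 1)) 0 0 (dist d.+1 (x' i) (x' j)))).
  apply: (psd_lim (A := fun n i j => fine (lens (EFin \o cap (nu - 1)) (harmonic n) (harmonic n) (dist d.+1 (x' i) (x' j))))).
    by move=> n; apply: psd_lens_cap; [rewrite subrK|exact: harmonic_gt0].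
  move=> i j; apply: fine_cvg; rewrite fineK; first exact: lens_cap_cvg.
  by rewrite lens_cap00// dist_ge0.
have /andP[h1 h2] := tent_int k0.
set c3 := fine (\int[mu]_v (tent (nu - 1) v)%:E)%E.
have c30 : 0 < c3 by apply: fine_gt0; rewrite h1.
move=> /(psdZ (_ : 0 <= c3^-1)); rewrite invr_ge0 ltW// => /(_ isT).
apply: eq_psd => i j; rewrite lens_cap00// ?dist_ge0// -/c3 /= subrK mulrC mulfK ?gt_eqF//.
congr pos_pow; rewrite distZ; last by rewrite divr_ge0// ltW.
by field; rewrite gt_eqF.
Qed.

End askey.

(** * The Beta mixture *)
Section beta_mixture.
Context {R : realType}.
Local Notation mu := (@lebesgue_measure R).
Implicit Types (g r w nu : R).

Definition beta_slice nu r g w : R :=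
  if (0 < w) && (w < 1) then w `^ nu * pos_pow nu (1 - r / w) * (1 - w) `^ g else 0.

Lemma beta_slice_ge0 nu r g w : 0 <= beta_slice nu r g w.
Proof. by rewrite /beta_slice; case: ifP => // _; rewrite !mulr_ge0 ?powR_ge0. Qed.

Lemma measurable_beta_slice nu r g : measurable_fun setT (beta_slice nu r g).
Proof.
(* For [w > 0] the first two factors combine to [pos_pow nu (w - r)], which avoids the division. *)
apply: (@eq_measurable_fun _ _ _ _ _ (fun w =>
    if (0 < w) && (w < 1) then pos_pow nu (w - r) * (1 - w) `^ g else 0)).
  move=> w _; rewrite /beta_slice; case: ifP => // /andP[w0 _].
  rewrite /pos_pow -powRM ?(ltW w0)//; last by rewrite le_max lexx orbT.
  rewrite maxr_pMr ?ltW// mulr0.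
  by congr (_ `^ _ * _); congr Num.max; field; rewrite gt_eqF.
apply: measurable_fun_ifT; last exact: measurable_cst.
  by apply: measurable_and; exact: measurable_fun_ltr.
apply: measurable_funM.
  by apply: (measurableT_comp (measurable_pos_pow nu)); meas.
by apply: (measurableT_comp (measurable_powR _)); meas.
Qed.

(** For nonnegative exponents the integrand is at most 1, so the integral is finite and [fine] loses
    nothing. *)
Lemma EFin_Beta a b : 0 <= a -> 0 <= b ->
  ((Beta (a + 1) (b + 1))%:E =
   \int[mu]_t (if (0 < t) && (t < 1) then t `^ a * (1 - t) `^ b else 0)%:E)%E.
Proof.
move=> a0 b0; rewrite /Beta /Rintegral !addrK integral_mkcond.
rewrite (_ : (\int[mu]_t _)%E = \int[mu]_t (if (0 < t) && (t < 1) then t `^ a * (1 - t) `^ b else 0)%:E)%E; last first.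
  by apply: eq_integral => t _; rewrite patchE mem_setE in_itv/=; case: ifP.
rewrite fineK// ge0_fin_numE; last first.
  by apply: integral_ge0 => t _; rewrite lee_fin; case: ifP => // _; rewrite mulr_ge0 ?powR_ge0.
apply: (@le_lt_trans _ _ (2 * 1)%:E); last exact: ltry.
apply: integral_unit_bound.
- apply/measurable_EFinP; apply: measurable_fun_ifT; last exact: measurable_cst.
    by apply: measurable_and; exact: measurable_fun_ltr.
  apply: measurable_funM; first exact: measurable_powR.
  by apply: (measurableT_comp (measurable_powR _)); meas.
- by move=> t; rewrite lee_fin; case: ifP => // _; rewrite mulr_ge0 ?powR_ge0.
- move=> t; rewrite lee_fin; case: ifP => // /andP[t0 t1].
  have pw e y : 0 <= e -> 0 <= y -> y <= 1 -> y `^ e <= 1 :> R.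
    move=> e0 y0 y1; rewrite -[leRHS](_ : 1 `^ e = 1 :> R); last by rewrite powR1.
    by apply: ge0_ler_powR; rewrite ?nnegrE.
  by apply: mulr_ile1; rewrite ?powR_ge0// pw//; lra.
- move=> t t1; rewrite ifF//; apply/negbTE/negP => /andP[t0 t1'].
  by move: t1; rewrite leNgt expr_lt1 ?ltW// t1'.
Qed.

(* The substitution [w = 1 - (1 - r) t]. *)
Lemma integral_beta_slice nu r g : 0 < nu -> 0 <= r -> 0 <= g ->
  (\int[mu]_w (beta_slice nu r g w)%:E =
   (Beta (g + 1) (nu + 1) * Psi (nu + g + 1) r)%:E)%E.
Proof.
move=> nu0 r0 g0.
have mb := measurable_beta_slice nu r g.
rewrite -[Psi _ _]/(pos_pow (nu + g + 1) (1 - r)).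
(* For [r >= 1] both sides vanish; [nu > 0] matters here, as zero to the power zero is 1. *)
have [r1|r1] := leP (1 - r) 0.
  rewrite /pos_pow max_r// powR0 ?mulr0; last by rewrite gt_eqF; lra.
  rewrite integral0_eq// => w _; rewrite /beta_slice; case: ifP => // /andP[w0 w1].
  rewrite /pos_pow max_r ?powR0 ?gt_eqF ?mulr0 ?mul0r//.
  by rewrite subr_le0 ler_pdivlMr// mul1r; lra.
rewrite mulrC EFinM EFin_Beta// ?(ltW nu0)//.
rewrite -[LHS](@integral_translate _ _ 1); last 2 first.
- exact/measurable_EFinP.
- by move=> w; rewrite lee_fin beta_slice_ge0.
rewrite -(@integral_oppr _ (fun w => (beta_slice nu r g (w + 1))%:E)); last 2 first.
- by apply/measurable_EFinP; apply: (measurableT_comp mb); meas.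
- by move=> w; rewrite lee_fin beta_slice_ge0.
rewrite -(integral_scale r1 (f := fun w => (beta_slice nu r g (- w + 1))%:E)); last 2 first.
- by apply/measurable_EFinP; apply: (measurableT_comp mb); meas.
- by move=> w; rewrite lee_fin beta_slice_ge0.
rewrite -!ge0_integralZl_EFin ?pos_pow_ge0 ?(ltW r1)//; last 4 first.
- by move=> t _; rewrite lee_fin; case: ifP => // _; rewrite mulr_ge0 ?powR_ge0.
- apply/measurable_EFinP; apply: measurable_fun_ifT; last exact: measurable_cst.
    by apply: measurable_and; exact: measurable_fun_ltr.
  apply: measurable_funM; first exact: measurable_powR.
  by apply: (measurableT_comp (measurable_powR _)); meas.
- by move=> t _; rewrite lee_fin beta_slice_ge0.
- apply/measurable_EFinP; apply: (measurableT_comp mb); apply: measurable_funD => //.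
  by apply: (measurableT_comp (@oppr_measurable R setT)); meas.
apply: eq_integral => t _; rewrite -!EFinM; congr EFin.
rewrite /beta_slice (pos_powE _ (ltW r1)).
have -> : (- ((1 - r) * t) + 1 < 1) = (0 < t) by rewrite gtrDr oppr_lt0 pmulr_rgt0.
have [t0|t0] := ltP 0 t; last by rewrite andbF !mulr0.
rewrite andbT /=; have [t1|t1] := ltP t 1; last first.
  rewrite mulr0; case: ifPn => [w0|_]; last by rewrite mulr0.
  rewrite /pos_pow max_r ?powR0 ?gt_eqF ?mulr0 ?mul0r ?mulr0//.
  rewrite subr_le0 ler_pdivlMr// mul1r.
  have : (1 - r) * 1 <= (1 - r) * t by rewrite ler_pM2l.
  lra.
have rt : (1 - r) * t < 1 - r by rewrite gtr_pMr.
have w0 : 0 < - ((1 - r) * t) + 1 by lra.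
have t1' : 0 < 1 - t by rewrite subr_gt0.
rewrite w0 pos_powE; last by rewrite subr_ge0 ler_pdivrMr// mul1r; lra.
rewrite -powRM ?(ltW w0)//; last by rewrite subr_ge0 ler_pdivrMr// mul1r; lra.
(* Here [w - r = (1 - r) (1 - t)] and [1 - w = (1 - r) t]; together with the Jacobian they give the
   exponent [nu + g + 1]. *)
have -> : (- ((1 - r) * t) + 1) * (1 - r / (- ((1 - r) * t) + 1)) = (1 - r) * (1 - t).
  by rewrite mulrBr mulrCA mulfV ?gt_eqF//; ring.
have -> : 1 - (- ((1 - r) * t) + 1) = (1 - r) * t by ring.
rewrite !powRM ?ltW//.
have rn0 : 1 - r != 0 by rewrite gt_eqF.
have -> : (1 - r) `^ (nu + g + 1) = (1 - r) * (1 - r) `^ nu * (1 - r) `^ g.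
  rewrite -{2}[1 - r]powRr1 ?(ltW r1)// -!powRD ?rn0 ?implybT//.
  by congr (_ `^ _); ring.
by ring.
Qed.

End beta_mixture.

(** * Matrix-valued kernels as scalar kernels on pairs *)

Section matrix_kernels.
Context {R : realType}.

Lemma kernel_formE d m (K : mkernel R d m) n (x : 'I_n -> 'cV[R]_d)
    (a : 'I_n -> 'cV[R]_m) :
  kernel_form K x a =
  qform (fun u w : 'I_n * 'I_m => K (x u.1) (x w.1) u.2 w.2) (fun u => a u.1 u.2 0).
Proof.
rewrite /kernel_form /qform.
rewrite -(pair_bigA _ (fun i k => \sum_w a i k 0 * a w.1 w.2 0 * K (x i) (x w.1) k w.2))/=.
apply: eq_bigr => i _.
under [RHS]eq_bigr do rewrite -(pair_bigA _ (fun j l => a i _ 0 * a j l 0 * K (x i) (x j) _ l))/=.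
rewrite exchange_big/=; apply: eq_bigr => j _.
rewrite mxE exchange_big/=; apply: eq_bigr => l _.
rewrite mxE mulr_suml; apply: eq_bigr => k _; rewrite !mxE; ring.
Qed.

(** On pairs, the constraint on [a] says exactly that all scalar coefficients sum to zero, which is
    the condition in [psd_exp_cnd]. *)
Lemma cnd_qform d m (K : mkernel R d m) n (x : 'I_n -> 'cV[R]_d)
    (c : 'I_n * 'I_m -> R) :
  conditionally_negative_definite K -> \sum_u c u = 0 ->
  qform (fun u w : 'I_n * 'I_m => K (x u.1) (x w.1) u.2 w.2) c <= 0.
Proof.
move=> [_ cK] c0; have := cK n x (fun i => \col_k c (i, k)); rewrite kernel_formE.
have -> : (fun u : 'I_n * 'I_m => (\col_k c (u.1, k)) u.2 0) = c.
  by apply/funext => -[i k]; rewrite mxE.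
apply; apply/matrixP => i j; rewrite !ord1 !mxE -[RHS]c0.
transitivity (\sum_k \sum_i c (i, k)).
  by apply: eq_bigr => k _; rewrite !mxE mul1r summxE; apply: eq_bigr => l _; rewrite mxE.
by rewrite exchange_big/= pair_bigA/=; apply: eq_bigr => -[].
Qed.

(** Padding by zeros gives the sequences on which [dist] operates. *)
Definition coord d (v : 'cV[R]_d) (k : nat) : R :=
  if insub k is Some i then v i 0 else 0.

Lemma euclidean_norm_dist d (x y : 'cV[R]_d) :
  euclidean_norm (x - y) = dist d (coord x) (coord y).
Proof.
rewrite /euclidean_norm /dist; congr Num.sqrt; apply: eq_bigr => k _.
by rewrite /coord valK !mxE.
Qed.

End matrix_kernels.

Theorem proposition5p1 (R : realType) (d m : nat)
    (gamma : mkernel R d m)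
    (gamma_gt0 : forall (x y : 'cV[R]_d) (i j : 'I_m), 0 < gamma x y i j)
    (gamma_cnd : conditionally_negative_definite gamma)
    (s : R) (s_gt0 : 0 < s)
    (nu : R) (nu_ge : (d%:R + 1) / 2 <= nu)
    (C : mkernel R d m)
    (C_def : forall (x y : 'cV[R]_d) (i j : 'I_m),
       C x y i j =
         s `^ (nu + 1) * Beta (gamma x y i j + 1) (nu + 1) *
         Psi (nu + gamma x y i j + 1) (euclidean_norm (x - y) / s)) :
  positive_definite C /\ compactly_supported C.
Proof.
have [gamma_sym _] := gamma_cnd.
have nu0 : 0 < nu by have := ler0n R d; lra.
split; last first.
  exists s => x y xy; apply/matrixP => i j; rewrite C_def mxE.
  rewrite /Psi max_r; first by rewrite powR0 ?mulr0// gt_eqF// !addr_gt0.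
  by rewrite subr_le0 ler_pdivlMr// mul1r ltW.
split.
  move=> x y i j; rewrite !C_def gamma_sym; congr (_ * Psi _ (Num.sqrt _ / s)).
  by apply: eq_bigr => k _; rewrite !mxE -sqrrN opprB.
move=> n x a; rewrite kernel_formE.
pose r (u w : 'I_n * 'I_m) := dist d (coord (x u.1)) (coord (x w.1)) / s.
pose g (u w : 'I_n * 'I_m) := gamma (x u.1) (x w.1) u.2 w.2.
have r0 u w : 0 <= r u w by rewrite divr_ge0 ?dist_ge0 ?(ltW s_gt0).
have g0 u w : 0 <= g u w by apply: ltW; exact: gamma_gt0.
suff pC : psd (fun u w : 'I_n * 'I_m => C (x u.1) (x w.1) u.2 w.2) by exact: pC.
apply: (@eq_psd _ _ (fun u w => s `^ (nu + 1) *
    fine (\int[@lebesgue_measure R]_t (beta_slice nu (r u w) (g u w) t)%:E)%E)).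
  move=> u w; rewrite C_def integral_beta_slice//= euclidean_norm_dist.
  by rewrite mulrA.
apply: psdZ; first exact: powR_ge0.
apply: psd_integral.
- move=> t; have [/andP[t0 t1]|t01] := boolP ((0 < t) && (t < 1)); last first.
    apply: (@eq_psd _ _ (fun _ _ => 0 * 0)); last exact: psd_rank1.
    by move=> u w; rewrite mulr0 /beta_slice (negbTE t01).
  have A : psd (fun u w => pos_pow nu (1 - r u w / t)).
    (* The Askey function of radius [s * t], since distances are already divided by [s] in [r]. *)
    have := @psd_askey R d nu (s * t) _ (fun u : 'I_n * 'I_m => coord (x u.1)) nu_ge (mulr_gt0 s_gt0 t0).
    by apply: eq_psd => u w; rewrite /r invfM mulrA.
  (* This is [(1 - t)] to the power [g u w]; [- ln (1 - t)] is nonnegative on [(0, 1)], as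
     Schoenberg's argument requires. *)
  have E : psd (fun u w => expR (- (- ln (1 - t)) * g u w)).
    apply: psd_exp_cnd.
    - by rewrite oppr_ge0 ln_le0// gerBl ltW.
    - by move=> u w; exact: gamma_sym.
    - by move=> c c0; exact: (@cnd_qform R d m gamma n x c gamma_cnd c0).
  have S : symm (fun u w => pos_pow nu (1 - r u w / t)).
    move=> u w; rewrite /r /dist; congr (pos_pow nu (1 - Num.sqrt _ / s / t)).
    by apply: eq_bigr => k _; rewrite -sqrrN opprB.
  have := psdZ (powR_ge0 t nu) (psd_schur S A E).
  apply: eq_psd => u w; rewrite mulrA /beta_slice t0 t1; congr (_ * _).
  by rewrite opprK mulrC /powR gt_eqF// subr_gt0.
- by move=> t u w; exact: beta_slice_ge0.
- by move=> u w; exact: measurable_beta_slice.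
- by move=> u w; rewrite integral_beta_slice// ltry.
Qed.
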